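(* For every integer $n\ge 1$, the antibandwidth of the $n$-cube $Q^{(n)}$ is $$f(Q^{(n)}) = 2^{n-1}-\sum_{m=0}^{n-2}\binom{m}{\lfloor m/2\rfloor}.$$
   Context: The $n$-cube $Q^{(n)}$ is the graph with vertex set $\{0,1\}^n$ in which two vertices are adjacent iff they differ in exactly one coordinate. A numbering of a finite graph $G=(V,E)$ is a bijection $\eta:V\to\{1,2,\dots,|V|\}$. The antibandwidth of $G$ is $f(G)=\max_{\eta}\min_{\{v,w\}\in E}|\eta(v)-\eta(w)|$, the maximum taken over all numberings $\eta$ of $G$. An empty sum equals $0$. *)

(* Defs.v *)
From mathcomp Require Import all_boot.
Set Implicit Arguments. Unset Strict Implicit. Unset Printing Implicit Defensive.

(* A numbering is a bijection V -> {1,...,|V|}; these are exactly v |-> g v + 1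
   for g : V -> 'I_#|V| injective (hence bijective, by cardinality). *)

Definition absdiff (a b : nat) : nat := (a - b) + (b - a).

(* min over edges {v,w} of |eta v - eta w|; empty-edge default #|T| (irrelevant here). *)
Definition min_edge_gap (T : finType) (e : rel T) (eta : T -> nat) : nat :=
  \big[minn/#|T|]_(p : T * T | e p.1 p.2) absdiff (eta p.1) (eta p.2).

(* Antibandwidth: the maximum, over all numberings, of the min edge gap.
   We characterise it as the largest value attained: f = max.  We define it via
   finite functions into 'I_#|T| (shifted by 1), which enumerate all numberings. *)
Definition antibandwidth (T : finType) (e : rel T) : nat :=
  \max_(g : {ffun T -> 'I_#|T|} | injectiveb g)
     min_edge_gap e (fun v => (g v).+1).

Definition cube_vertex (n : nat) := {ffun 'I_n -> bool}.
Definition cube_adj (n : nat) : rel (cube_vertex n) :=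
  fun x y => #|[set i | x i != y i]| == 1.

(* Main.v *)
(* Dropping a coordinate identifies both the even and the odd vertices of the n-cube with the
   vertices of the N-cube, N = n - 1; nonadjacency of even and odd vertices becomes distance >= 2.
   Put M = 2 ^ N, D = \sum_(m < N) 'C(m, m./2), k = M - D + 1.

   Lower bound: number the even vertices and then the odd ones, both in the simplicial (Hales)
   order; every initial segment of the N-cube has vertex boundary at most D.

   Upper bound: by Harper's theorem there are sizes p <= q, p + q = k, such that p vertices of one
   parity and q of the other always span an edge. Suppose that all gaps are >= k. Then a window of
   k positions is independent, so it contains neither p nor q even vertices, and sliding it shows
   that one of three cases holds for all windows.
   If all windows have more than q even (or odd) vertices, a monotone potential contradicts the fact
   that half of all vertices are even.
   If all windows have between p and q even vertices and N is small, the same happens with pairs of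
   concentric windows of lengths 2p and 2q.
   If N >= 7, orient every edge by its numbering and compare with its orientation from even to odd.
   The resulting sign is balanced on all squares, hence of the form gam x (+) gam y. The vertices
   meeting both signs then form two vertex cuts, one of even and one of odd vertices, with fewer
   than 2D - 1 vertices in total, while the parts that they cut off have at least 2p + 2 vertices
   in total; this contradicts the isoperimetric inequality in the n-cube itself. *)
Require Import Defs.
From mathcomp Require Import all_boot zify.
Set Implicit Arguments. Unset Strict Implicit. Unset Printing Implicit Defensive.

(** * The simplicial order *)

Section CubeOrder.
Variable m : nat.
Implicit Types (x y z S : {set 'I_m}) (A B I J : {set {set 'I_m}}) (i j d : 'I_m).

(* The weight [wt] sorts sets by cardinality and then lexicographically. It is additive, so that
   inserting one fixed element preserves the order. *)
Definition letter_wt (i : 'I_m) : nat := 2 ^ m - 2 ^ (m - i.+1).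
Definition wt x : nat := \sum_(i in x) letter_wt i.

Lemma letter_wt_gt0 i : 0 < letter_wt i.
Proof.
rewrite /letter_wt subn_gt0 ltn_exp2l //; have := ltn_ord i; lia.
Qed.

Lemma letter_wt_lt i j : i < j -> letter_wt i < letter_wt j.
Proof.
move=> ij; rewrite /letter_wt.
have h1 : 2 ^ (m - j.+1) < 2 ^ (m - i.+1).
  by rewrite ltn_exp2l //; have := ltn_ord j; lia.
have h2 : 2 ^ (m - i.+1) <= 2 ^ m by rewrite leq_exp2l //; lia.
lia.
Qed.

Lemma wtU1 i x : i \notin x -> wt (i |: x) = letter_wt i + wt x.
Proof. by move=> ix; rewrite /wt big_setU1. Qed.

Lemma wtD1 i x : i \in x -> wt x = letter_wt i + wt (x :\ i).
Proof. by move=> ix; rewrite /wt (big_setD1 i). Qed.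

Lemma wt0 : wt set0 = 0.
Proof. by rewrite /wt big_set0. Qed.

(** The set read as a binary number whose leading digit is coordinate 0. By [wt_binval] the weight
    is [#|x| * 2 ^ m] minus this number, which is how an additive weight can sort lexicographically
    within each cardinality. *)
Definition binval x : nat := \sum_(i in x) 2 ^ (m - i.+1).

Lemma binval_bound d x : (forall i, i \in x -> d < i) -> binval x < 2 ^ (m - d.+1).
Proof.
move=> xd.
have : binval x <= \sum_(i < m | d < i) 2 ^ (m - i.+1).
  rewrite /binval big_mkcond [leqRHS]big_mkcond; apply: leq_sum => i _.
  by case: ifP => // /xd ->.
have -> : \sum_(i < m | d < i) 2 ^ (m - i.+1) = 2 ^ (m - d.+1) - 1.
  have := ltn_ord d; move: (d : nat) => e em {xd}.
  rewrite big_mkcond.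
  elim: m em => [|n IH] //; rewrite ltnS leq_eqVlt => /orP[/eqP->|en].
    rewrite subnn big1 // => i _; case: ifP => // h.
    by have := ltn_ord i; lia.
  rewrite big_ord_recr /= en subnn expn0.
  have -> : \sum_(i < n) (if e < i then 2 ^ (n.+1 - i.+1) else 0) =
            2 * \sum_(i < n) (if e < i then 2 ^ (n - i.+1) else 0).
    rewrite big_distrr /=; apply: eq_bigr => i _; case: ifP => // _.
    by rewrite -expnS; congr (_ ^ _); have := ltn_ord i; lia.
  rewrite IH //.
  have -> : n.+1 - e.+1 = (n - e.+1).+1 by lia.
  have : 0 < 2 ^ (n - e.+1) by rewrite expn_gt0.
  rewrite expnS; lia.
have : 0 < 2 ^ (m - d.+1) by rewrite expn_gt0.
lia.
Qed.

Lemma wt_binval x : wt x + binval x = #|x| * 2 ^ m.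
Proof.
rewrite /wt /binval -big_split /= -sum_nat_const; apply: eq_bigr => i _.
rewrite /letter_wt subnK // leq_exp2l //; lia.
Qed.

Lemma binval_lt x : binval x < 2 ^ m.
Proof.
have [m0|m0] := posnP m.
  have -> : binval x = 0.
    by rewrite /binval big1 // => i; have := ltn_ord i; rewrite {2}m0.
  by rewrite expn_gt0.
pose o := Ordinal m0.
have h := @binval_bound o (x :\ o).
have h1 : binval (x :\ o) < 2 ^ (m - 1).
  apply: h => i; rewrite !inE => /andP[io _]; rewrite lt0n.
  by apply: contra io => /eqP i0; apply/eqP/val_inj.
have e : 2 ^ m = 2 ^ (m - 1) + 2 ^ (m-1) by rewrite addnn -mul2n -expnS; congr (_ ^ _); lia.
have [ox|ox] := boolP (o \in x); last first.
  have -> : x = x :\ o.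
    by apply/setP => i; rewrite !inE; case: eqP => // ->; rewrite (negbTE ox).
  by rewrite e; lia.
have -> : binval x = 2 ^ (m - 1) + binval (x :\ o) by rewrite /binval (big_setD1 o).
by rewrite e; lia.
Qed.

(** One more element adds [2 ^ m] to the sum of [wt] and [binval], and [binval] alone stays below
    [2 ^ m]. *)
Lemma wt_card x y : #|x| < #|y| -> wt x < wt y.
Proof.
move=> xy; have := wt_binval x; have := wt_binval y; have := binval_lt y.
have : #|x| * 2 ^ m + 2 ^ m <= #|y| * 2 ^ m by rewrite -mulSnr leq_mul2r xy orbT.
lia.
Qed.

(** At equal cardinality a larger binary number means a smaller weight, and the digit at [d]
    outweighs all later digits together. *)
Lemma wt_lex d x y : #|x| = #|y| -> d \in x -> d \notin y ->
  (forall i, i < d -> (i \in x) = (i \in y)) -> wt x < wt y.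
Proof.
move=> cxy dx dy agree; have := wt_binval x; have := wt_binval y; rewrite cxy.
suff : binval y < binval x by lia.
rewrite /binval (bigID (fun i : 'I_m => i < d)) [ltnRHS](bigID (fun i : 'I_m => i < d)) /=.
have -> : \sum_(i in y | i < d) 2 ^ (m - i.+1) = \sum_(i in x | i < d) 2 ^ (m - i.+1).
  by apply: eq_bigl => i; case: (ltnP i d) => id; rewrite ?andbF ?andbT // agree.
rewrite ltn_add2l [ltnRHS](bigD1 d) /= ?dx ?ltnn //.
apply: ltn_addr.
have -> : \sum_(i in y | ~~ (i < d)) 2 ^ (m - i.+1) = binval [set i in y | ~~ (i < d)].
  by apply: eq_bigl => i; rewrite inE.
apply: binval_bound => i; rewrite inE -leqNgt => /andP[iy di]; rewrite ltn_neqAle di andbT.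
by apply: contraNneq dy => /val_inj ->.
Qed.

Lemma min_diff x y : x != y -> exists d, (d \in x) != (d \in y) /\
  (forall i, i < d -> (i \in x) = (i \in y)).
Proof.
move=> nxy.
have [d0 hd0] : exists d, (d \in x) != (d \in y).
  apply/existsP; rewrite -negb_forall; apply: contra nxy => /forallP h.
  by apply/eqP/setP => i; apply/eqP.
case: (@arg_minnP _ d0 (fun d => (d \in x) != (d \in y)) val hd0) => d hd hmin.
exists d; split=> // i id; apply/eqP; apply: contraTT id => h.
by rewrite -leqNgt; exact: hmin.
Qed.

Lemma wt_inj : injective wt.
Proof.
move=> x y e; apply/eqP; apply: contraT => nxy.
have [c|c|c] := ltngtP #|x| #|y|.
- by have := wt_card c; rewrite e ltnn.
- by have := wt_card c; rewrite e ltnn.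
have [d [hd ag]] := min_diff nxy.
have [dx|dx] := boolP (d \in x).
  have dy : d \notin y by move: hd; rewrite dx; case: (d \in y).
  by have := wt_lex c dx dy ag; rewrite e ltnn.
have dy : d \in y by move: hd; rewrite (negbTE dx); case: (d \in y).
have ag' i : i < d -> (i \in y) = (i \in x) by move=> h; rewrite ag.
by have := wt_lex (esym c) dy dx ag'; rewrite e ltnn.
Qed.

Lemma wt_neq x y : x != y -> wt x != wt y.
Proof. by apply: contra => /eqP/wt_inj ->. Qed.

Lemma wt_lexV x y : #|x| = #|y| -> wt x < wt y -> exists d,
  [/\ d \in x, d \notin y & forall i, i < d -> (i \in x) = (i \in y)].
Proof.
move=> c h; have nxy : x != y by apply: contraTneq h => ->; rewrite ltnn.
have [d [hd ag]] := min_diff nxy; exists d.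
have [dx|dx] := boolP (d \in x).
  by split=> //; move: hd; rewrite dx; case: (d \in y).
have dy : d \in y by move: hd; rewrite (negbTE dx); case: (d \in y).
have ag' i : i < d -> (i \in y) = (i \in x) by move=> hi; rewrite ag.
by have := wt_lex (esym c) dy dx ag'; lia.
Qed.

Lemma wt_le_card x y : wt x <= wt y -> #|x| <= #|y|.
Proof. by move=> h; rewrite leqNgt; apply: contraL h => /wt_card; rewrite -ltnNge. Qed.

End CubeOrder.

(** * Initial segments and their neighbourhoods *)

Section Harper.
Variable m : nat.
Implicit Types (x y z S : {set 'I_m}) (A B I J : {set {set 'I_m}}) (i j d : 'I_m).

(** Everything is relative to the subcube of subsets of [S]. Inductions on the dimension then shrink
    [S] and keep the type and the weight fixed. *)
Definition initial S I := I \subset powerset S /\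
  forall x y, x \in I -> y \subset S -> wt y < wt x -> y \in I.

Lemma initial_sub S I x : initial S I -> x \in I -> x \subset S.
Proof. by case=> sI _ xI; have := subsetP sI x xI; rewrite powersetE. Qed.

Lemma initial_le S I x y : initial S I -> x \in I -> y \subset S -> wt y <= wt x -> y \in I.
Proof.
move=> hI xI yS; rewrite leq_eqVlt => /orP[/eqP/wt_inj-> //|].
by case: hI => _; apply.
Qed.

Lemma initial_total S I J : initial S I -> initial S J -> I \subset J \/ J \subset I.
Proof.
move=> hI hJ; have [sIJ|/subsetPn[x xI xJ]] := boolP (I \subset J); first by left.
right; apply/subsetP => y yJ; apply: (initial_le hI xI (initial_sub hJ yJ)).
rewrite leqNgt; apply: contra xJ => h.
exact: (initial_le hJ yJ (initial_sub hI xI) (ltnW h)).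
Qed.

Lemma initial_subset S I J : initial S I -> initial S J -> #|I| <= #|J| -> I \subset J.
Proof.
move=> hI hJ c; case: (initial_total hI hJ) => // sJI.
by have /eqP-> : J == I by rewrite eqEcard sJI.
Qed.

Lemma initial_eq S I J : initial S I -> initial S J -> #|I| = #|J| -> I = J.
Proof.
by move=> hI hJ c; apply/eqP; rewrite eqEcard c leqnn andbT; apply: initial_subset hI hJ _; rewrite c.
Qed.

Lemma initial_powerset S : initial S (powerset S).
Proof. by split=> // x y _ yS _; rewrite powersetE. Qed.

Lemma initialD1 S I x : initial S I -> x \in I -> (forall y, y \in I -> wt y <= wt x) ->
  initial S (I :\ x).
Proof.
move=> hI xI xmax; split.
  by apply: subset_trans (subsetDl _ _) _; case: hI.
move=> y z; rewrite !inE => /andP[yx yI] zS zy; rewrite (initial_le hI yI zS (ltnW zy)) andbT.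
by apply: contraTneq zy => ->; rewrite -leqNgt xmax.
Qed.

Lemma max_wt A : A != set0 -> exists2 x, x \in A & forall y, y \in A -> wt y <= wt x.
Proof.
case/set0Pn => x0 x0A; case: (@arg_maxnP _ x0 (mem A) (@wt m) x0A) => x xA xmax.
by exists x => // y /xmax.
Qed.

Lemma min_wt A : A != set0 -> exists2 x, x \in A & forall y, y \in A -> wt x <= wt y.
Proof.
case/set0Pn => x0 x0A; case: (@arg_minnP _ x0 (mem A) (@wt m) x0A) => x xA xmin.
by exists x => // y /xmin.
Qed.

Lemma initial_exists S t : t <= 2 ^ #|S| -> exists2 I, initial S I & #|I| = t.
Proof.
move=> tS.
have : forall c, c <= 2 ^ #|S| -> exists2 I, initial S I & #|I| = 2 ^ #|S| - c.
  elim=> [|c IH] hc.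
    by exists (powerset S); [exact: initial_powerset | rewrite card_powerset subn0].
  have [I hI cI] := IH (ltnW hc).
  have [|x xI xmax] := @max_wt I; first by rewrite -card_gt0 cI; lia.
  exists (I :\ x); first exact: initialD1.
  by have := cardsD1 x I; rewrite xI; lia.
move=> /(_ (2 ^ #|S| - t)) [|I hI cI]; first exact: leq_subr.
by exists I => //; lia.
Qed.

(** The differences of [I] and [A] have equal size, and every set of [I :\: A] is strictly lighter
    than the lightest set of [A :\: I]. The total weight is the termination measure for
    compressions, hence the equality case. *)
Lemma initial_sum_le S I A : initial S I -> A \subset powerset S -> #|I| = #|A| ->
  \sum_(x in I) wt x <= \sum_(x in A) wt x ?= iff (I == A).
Proof.
move=> hI sA c; apply/leqifP; case: eqP => [-> //|/eqP nIA].
have cD : #|I :\: A| = #|A :\: I|.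
  by have := cardsID A I; have := cardsID I A; rewrite setIC; lia.
rewrite (big_setID A) [ltnRHS](big_setID I) /= [A :&: I]setIC ltn_add2l.
have pos : 0 < #|A :\: I|.
  rewrite card_gt0; apply: contra nIA => /eqP e; rewrite eqEcard c leqnn andbT.
  by move: cD; rewrite e cards0 => /eqP; rewrite cards_eq0 setD_eq0.
have [|y yD ymin] := @min_wt (A :\: I); first by rewrite -card_gt0.
have lb : #|A :\: I| * wt y <= \sum_(x in A :\: I) wt x.
  by rewrite -sum_nat_const; apply: leq_sum => x /ymin.
have ub : \sum_(x in I :\: A) (wt x).+1 <= \sum_(x in I :\: A) wt y.
  apply: leq_sum => x; rewrite inE => /andP[xA xI]; move: yD; rewrite inE => /andP[yI yA].
  rewrite ltnNge; apply: contra yI => h; apply: (initial_le hI xI _ h).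
  by have := subsetP sA y yA; rewrite powersetE.
move: ub; rewrite sum_nat_const.
under eq_bigr => x _ do rewrite -addn1.
rewrite big_split /= sum1_card cD => ub.
by apply: leq_trans (leq_trans ub lb); rewrite -addn1 leq_add2l.
Qed.

Definition flip i x : {set 'I_m} := if i \in x then x :\ i else i |: x.

Lemma in_flip i j x : (j \in flip i x) = (j \in x) (+) (j == i).
Proof.
rewrite /flip; case: ifP => h; rewrite !inE; case: eqP => [->|] //=; rewrite ?h ?addbF //.
Qed.

Lemma flipK i : involutive (flip i).
Proof. by move=> x; apply/setP => j; rewrite !in_flip -addbA addbb addbF. Qed.

Lemma flipC i j x : flip i (flip j x) = flip j (flip i x).
Proof. by apply/setP => k; rewrite !in_flip -!addbA [(k == j) (+) _]addbC. Qed.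

Lemma flip_in i x : i \in x -> flip i x = x :\ i.
Proof. by rewrite /flip => ->. Qed.

Lemma flip_notin i x : i \notin x -> flip i x = i |: x.
Proof. by rewrite /flip => /negbTE->. Qed.

(** The closed neighbourhood: for [A] inside the subcube, the vertex boundary has
    [#|nbh S A| - #|A|] elements. *)
Definition nbh S A := [set z : {set 'I_m} | z \subset S & (z \in A) || [exists i in S, flip i z \in A]].

Lemma nbhP S A z : reflect (z \subset S /\ (z \in A \/ exists2 i, i \in S & flip i z \in A))
  (z \in nbh S A).
Proof.
rewrite inE; apply: (iffP andP) => -[zS h]; split=> //.
  case/orP: h => [|/existsP[i /andP[iS h]]]; first by left.
  by right; exists i.
case: h => [->//|[i iS h]]; apply/orP; right; apply/existsP; exists i; exact/andP.
Qed.

Lemma nbh_sub S A : nbh S A \subset powerset S.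
Proof. by apply/subsetP => z /nbhP[]; rewrite powersetE. Qed.

Lemma nbhS S A B : A \subset B -> nbh S A \subset nbh S B.
Proof.
move=> /subsetP sAB; apply/subsetP => z /nbhP[zS h]; apply/nbhP; split=> //.
by case: h => [/sAB|[i iS /sAB]]; [left | right; exists i].
Qed.

Lemma sub_nbh S A : A \subset powerset S -> A \subset nbh S A.
Proof.
move=> /subsetP sA; apply/subsetP => z zA; apply/nbhP; split; last by left.
by have := sA z zA; rewrite powersetE.
Qed.

Lemma nbhU S A B : nbh S (A :|: B) = nbh S A :|: nbh S B.
Proof.
apply/eqP; rewrite eqEsubset subUset !nbhS ?subsetUl ?subsetUr // !andbT.
apply/subsetP => z /nbhP[zS h]; rewrite in_setU; apply/orP.
case: h => [|[i iS]]; rewrite in_setU => /orP[] h.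
- by left; apply/nbhP; split=> //; left.
- by right; apply/nbhP; split=> //; left.
- by left; apply/nbhP; split=> //; right; exists i.
- by right; apply/nbhP; split=> //; right; exists i.
Qed.

Definition max_elt_spec x d := d \in x /\ forall i, i \in x -> i <= d.

Lemma max_elt x : x != set0 -> exists d, max_elt_spec x d.
Proof.
case/set0Pn => i0 i0x; case: (@arg_maxnP _ i0 (mem x) val i0x) => d dx dmax.
by exists d.
Qed.

Lemma letter_wt_le i j : i <= j -> letter_wt i <= letter_wt j.
Proof. by rewrite leq_eqVlt => /orP[/eqP/val_inj->//|/letter_wt_lt/ltnW]. Qed.

(* The lowest neighbour of a set arises by removing its largest element; this is monotone. *)
Lemma wt_remove_max x y d e : wt x < wt y -> max_elt_spec x d -> max_elt_spec y e ->
  wt (x :\ d) <= wt (y :\ e).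
Proof.
move=> xy [dx dmax] [ey emax].
have cx := cardsD1 d x; rewrite dx in cx; have cy := cardsD1 e y; rewrite ey in cy.
have := wt_le_card (ltnW xy); rewrite leq_eqVlt => /orP[/eqP c|c]; last first.
  by apply/ltnW/wt_card; move: c; rewrite cx cy !add1n ltnS.
have [f [fx fy ag]] := wt_lexV c xy.
have fe : f < e.
  rewrite ltnNge; apply: contraL (leqnn #|y|) => ef; rewrite -ltnNge -[ltnRHS]c (cardsD1 f x) fx ltnS.
  apply/subset_leq_card/subsetP => i iy; rewrite !inE.
  have nif : i != f by apply/eqP => eif; rewrite -eif iy in fy.
  rewrite nif ag //.
  by rewrite ltn_neqAle nif; exact: leq_trans (emax i iy) ef.
(* If [f] is not the largest element of [x], it is still the first difference after both deletions.
   If it is, the rest of [x] lies below [f], hence in [y], and the two remainders coincide. *)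
have [fd|fd] := eqVneq f d; last first.
  apply/ltnW; apply: (@wt_lex _ f); rewrite ?inE ?fd ?(negbTE fy) ?andbF //.
    by move: c; rewrite cx cy !add1n => -[].
  move=> i fi; rewrite !inE ag //; have := dmax f fx => fd'.
  have -> : i != d by apply: contraTneq fi => ->; rewrite -leqNgt.
  by have -> : i != e by apply: contraTneq fi => ->; rewrite -leqNgt ltnW.
suff /eqP-> : (x :\ d) == (y :\ e) by [].
rewrite eqEcard; apply/andP; split; last by move: c; rewrite cx cy !add1n => -[->].
apply/subsetP => i; rewrite !inE -fd => /andP[nif ix].
have lif : i < f by rewrite ltn_neqAle nif /= fd dmax.
rewrite -ag // ix andbT; apply: contraTneq lif => ->.
by rewrite -leqNgt ltnW.
Qed.

Lemma initial_down S I x i : initial S I -> x \in I -> x :\ i \in I.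
Proof.
move=> hI xI; apply: (initial_le hI xI).
  exact: subset_trans (subsetDl _ _) (initial_sub hI xI).
have [ix|ix] := boolP (i \in x); first by rewrite (wtD1 ix) leq_addl.
suff -> : x :\ i = x by [].
by apply/setP => j; rewrite !inE; case: eqP => // ->; rewrite (negbTE ix).
Qed.

(** A set outside [I] that has a neighbour in [I] must have obtained it by deleting an element.
    Deleting the largest element then also leads into [I], and by [wt_remove_max] this passes on to
    every earlier set. *)
Lemma initial_nbh S I : initial S I -> initial S (nbh S I).
Proof.
move=> hI; split; first exact: nbh_sub.
move=> z z' /nbhP[zS h] z'S lt; apply/nbhP; split=> //.
have [zI|zI] := boolP (z \in I); first by left; apply: (initial_le hI zI z'S (ltnW lt)).
case: h => [|[i iS fI]]; first by rewrite (negbTE zI).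
have iz : i \in z.
  apply: contraR zI => iz; rewrite (flip_notin iz) in fI.
  have := initial_down i hI fI; congr (_ \in I).
  by apply/setP => j; rewrite !inE; case: eqP => // ->; rewrite (negbTE iz).
rewrite (flip_in iz) in fI.
have [->|z'0] := eqVneq z' set0.
  by left; apply: (initial_le hI fI); rewrite ?sub0set ?wt0.
have [d dz'] := max_elt z'0.
have [e ez] : exists e, max_elt_spec z e by apply: max_elt; apply/set0Pn; exists i.
right; exists d; first by apply: (subsetP z'S); case: dz'.
rewrite flip_in; last by case: dz'.
have h1 := wt_remove_max lt dz' ez.
apply: (initial_le hI fI).
  exact: subset_trans (subsetDl _ _) z'S.
apply: leq_trans h1 _.
have := wtD1 iz; have := wtD1 (proj1 ez); have := letter_wt_le (proj2 ez i iz); lia.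
Qed.

End Harper.

(** * Harper's vertex-isoperimetric theorem *)

Section Sections.
Variable m : nat.
Implicit Types (x y z S : {set 'I_m}) (A B I J : {set {set 'I_m}}) (i j d : 'I_m).

(** The two halves of a family along coordinate [i]. Both are stored without [i], so that they are
    families in the same smaller cube and [glue] puts them back together. *)
Definition sec0 i A := [set x in A | i \notin x].
Definition sec1 i A := [set x : {set 'I_m} | (i \notin x) && (i |: x \in A)].
Definition glue i B0 B1 := [set x : {set 'I_m} | x \in if i \in x then [set i |: y | y in B1] else B0].

Lemma in_glue0 i B0 B1 x : i \notin x -> (x \in glue i B0 B1) = (x \in B0).
Proof. by move=> ix; rewrite inE (negbTE ix). Qed.

Lemma in_glue1 i B0 B1 x : i \notin x -> {in B1, forall y, i \notin y} ->
  (i |: x \in glue i B0 B1) = (x \in B1).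
Proof.
move=> ix hB; rewrite inE setU11; apply/imsetP/idP => [[y yB e]|xB]; last by exists x.
by rewrite -(setU1K ix) e setU1K // hB.
Qed.

Lemma powersetD1_notin S i B : B \subset powerset (S :\ i) -> {in B, forall y, i \notin y}.
Proof.
move=> /subsetP sB y /sB; rewrite powersetE => /subsetP h; apply/negP => /h.
by rewrite !inE eqxx.
Qed.

Lemma sec0_glue S i B0 B1 : B0 \subset powerset (S :\ i) -> sec0 i (glue i B0 B1) = B0.
Proof.
move=> s0; apply/setP => x; rewrite inE; have [ix|ix] := boolP (i \in x).
  by rewrite andbF; apply/esym/negP => /(powersetD1_notin s0); rewrite ix.
by rewrite andbT in_glue0.
Qed.

Lemma sec1_glue S i B0 B1 : B1 \subset powerset (S :\ i) -> sec1 i (glue i B0 B1) = B1.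
Proof.
move=> s1; apply/setP => x; rewrite [LHS]inE; have [ix|ix] := boolP (i \in x).
  by apply/esym/negP => /(powersetD1_notin s1); rewrite ix.
by rewrite in_glue1 //; exact: powersetD1_notin s1.
Qed.

Lemma glue_sub S i B0 B1 : i \in S -> B0 \subset powerset (S :\ i) ->
  B1 \subset powerset (S :\ i) -> glue i B0 B1 \subset powerset S.
Proof.
move=> iS /subsetP s0 /subsetP s1; apply/subsetP => x; rewrite inE powersetE.
case: ifP => _ h; last first.
  by move: (s0 x h); rewrite powersetE => /subset_trans; apply; apply: subsetDl.
case/imsetP: h => y /s1; rewrite powersetE => ys ->; rewrite subUset sub1set iS /=.
exact: subset_trans ys (subsetDl _ _).
Qed.

Lemma sec0_sub S i A : A \subset powerset S -> sec0 i A \subset powerset (S :\ i).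
Proof.
move=> /subsetP sA; apply/subsetP => x; rewrite !inE => /andP[/sA + ix].
by rewrite powersetE subsetD1 ix andbT.
Qed.

Lemma sec1_sub S i A : A \subset powerset S -> sec1 i A \subset powerset (S :\ i).
Proof.
move=> /subsetP sA; apply/subsetP => x; rewrite inE powersetE subsetD1 => /andP[ix /sA].
by rewrite powersetE subUset ix andbT => /andP[].
Qed.

Lemma sum_sections i A (F : {set 'I_m} -> nat) :
  \sum_(x in A) F x = \sum_(x in sec0 i A) F x + \sum_(x in sec1 i A) F (i |: x).
Proof.
rewrite (bigID (fun x => i \notin x)) /=; congr (_ + _).
  by apply: eq_bigl => x; rewrite inE.
rewrite (reindex_onto (fun x => i |: x) (fun x => x :\ i)) /=; last first.
  by move=> x /andP[_]; rewrite negbK => ix; rewrite setD1K.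
apply: eq_bigl => x; rewrite [in RHS]inE negbK setU11 andbT andbC; have [ix|ix] := boolP (i \in x) => /=.
  by apply/negP => /andP[/eqP e _]; move: ix; rewrite -e !inE eqxx.
by rewrite setU1K // eqxx.
Qed.

Lemma card_sections i A : #|A| = #|sec0 i A| + #|sec1 i A|.
Proof. by rewrite -!sum1_card (sum_sections i). Qed.

Lemma sum_wt_sections i A : \sum_(x in A) wt x =
  \sum_(x in sec0 i A) wt x + (\sum_(x in sec1 i A) wt x + #|sec1 i A| * letter_wt i).
Proof.
rewrite (sum_sections i); congr (_ + _); rewrite -sum_nat_const -big_split /=.
by apply: eq_bigr => x; rewrite inE => /andP[ix _]; rewrite wtU1 // addnC.
Qed.

Lemma setD1_notin i x : i \notin x -> x :\ i = x.
Proof. by move=> ix; apply/setP => j; rewrite !inE; case: eqP => // ->; rewrite (negbTE ix). Qed.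

Lemma flipU1 i j x : i != j -> flip i (j |: x) = j |: flip i x.
Proof.
move=> ij; apply/setP => k; rewrite in_flip !inE in_flip.
by case: (eqVneq k j) => [->|_] //=; rewrite eq_sym (negbTE ij).
Qed.

Lemma flip_id_notin i j x : i != j -> (j \in flip i x) = (j \in x).
Proof. by move=> ij; rewrite in_flip eq_sym (negbTE ij) addbF. Qed.

Lemma sec0_nbh S i A : i \in S -> A \subset powerset S ->
  sec0 i (nbh S A) = nbh (S :\ i) (sec0 i A) :|: sec1 i A.
Proof.
move=> iS sA; apply/setP => z; rewrite [LHS]inE in_setU.
have [iz|iz] := boolP (i \in z); rewrite /= ?andbF ?andbT.
  apply/esym/negP => /orP[/nbhP[]|]; last by rewrite inE iz.
  by rewrite subsetD1 iz andbF.
apply/nbhP/orP => [[zS]|].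
  case=> [zA|[j jS fA]].
    by left; apply/nbhP; rewrite subsetD1 zS iz inE zA iz; split=> //; left.
  have [eji|nji] := eqVneq j i.
    by right; rewrite inE iz -flip_notin // -eji.
  left; apply/nbhP; rewrite subsetD1 zS iz; split=> //; right; exists j.
    by rewrite !inE nji.
  by rewrite inE fA flip_id_notin.
case=> [/nbhP[]|].
  rewrite subsetD1 iz andbT => zS h; split=> //.
  case: h => [|[j]]; first by rewrite inE => /andP[zA _]; left.
  by rewrite !inE => /andP[_ jS] /andP[fA _]; right; exists j.
rewrite inE iz /= => h; split; last by right; exists i; rewrite // flip_notin.
by have := subsetP sA _ h; rewrite powersetE subUset => /andP[].
Qed.

Lemma sec1_nbh S i A : i \in S -> A \subset powerset S ->
  sec1 i (nbh S A) = nbh (S :\ i) (sec1 i A) :|: sec0 i A.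
Proof.
move=> iS sA; apply/setP => z; rewrite [LHS]inE in_setU.
have [iz|iz] := boolP (i \in z); rewrite /= ?andbF ?andbT.
  apply/esym/negP => /orP[/nbhP[]|]; last by rewrite inE iz andbF.
  by rewrite subsetD1 iz andbF.
apply/nbhP/orP => [[zS]|].
  have zS' : z \subset S by move: zS; rewrite subUset => /andP[].
  case=> [zA|[j jS fA]].
    by left; apply/nbhP; rewrite subsetD1 zS' iz inE zA iz; split=> //; left.
  have [eji|nji] := eqVneq j i.
    by right; move: fA; rewrite inE iz eji flip_in ?setU11 // setU1K // => ->.
  left; apply/nbhP; rewrite subsetD1 zS' iz; split=> //; right; exists j.
    by rewrite !inE nji.
  by rewrite inE flip_id_notin // iz -flipU1.
case=> [/nbhP[]|].
  rewrite subsetD1 iz andbT => zS h; split; first by rewrite subUset sub1set iS.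
  case: h => [|[j]]; first by rewrite inE => /andP[_ zA]; left.
  rewrite !inE => /andP[ji jS] /andP[_ fA]; right; exists j => //.
  by rewrite flipU1.
rewrite inE => /andP[zA _]; split; last first.
  by right; exists i => //; rewrite flip_in ?setU11 // setU1K.
by have := subsetP sA _ zA; rewrite powersetE subUset sub1set iS.
Qed.

(** Each half of the neighbourhood consists of the neighbourhood taken inside that half and of a
    copy of the opposite half, moved across coordinate [i]. *)
Lemma card_nbh_sections S i A : i \in S -> A \subset powerset S ->
  #|nbh S A| = #|nbh (S :\ i) (sec0 i A) :|: sec1 i A|
             + #|nbh (S :\ i) (sec1 i A) :|: sec0 i A|.
Proof. by move=> iS sA; rewrite (card_sections i) sec0_nbh // sec1_nbh. Qed.

Lemma initial_setU_card S I J : initial S I -> initial S J -> #|I :|: J| = maxn #|I| #|J|.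
Proof.
move=> hI hJ; case: (initial_total hI hJ) => s.
  by rewrite (setUidPr s); have := subset_leq_card s; lia.
by rewrite (setUidPl s); have := subset_leq_card s; lia.
Qed.

Lemma initial_sec0 S i I : initial S I -> initial (S :\ i) (sec0 i I).
Proof.
move=> hI; split; first by apply: sec0_sub; case: hI.
move=> x y; rewrite !inE => /andP[xI ix]; rewrite subsetD1 => /andP[yS ->] lt.
by rewrite andbT (initial_le hI xI yS (ltnW lt)).
Qed.

Lemma initial_sec1 S i I : i \in S -> initial S I -> initial (S :\ i) (sec1 i I).
Proof.
move=> iS hI; split; first by apply: sec1_sub; case: hI.
move=> x y; rewrite !inE => /andP[ix xI]; rewrite subsetD1 => /andP[yS iy] lt.
rewrite iy /=; apply: (initial_le hI xI); first by rewrite subUset sub1set iS.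
by rewrite !wtU1 // leq_add2l ltnW.
Qed.

End Sections.

Section HarperTheorem.
Variable m : nat.
Implicit Types (x y z S : {set 'I_m}) (A B I J : {set {set 'I_m}}) (i j d : 'I_m).

Definition initialb S I := (I \subset powerset S) &&
  [forall x in I, forall y : {set 'I_m}, (y \subset S) ==> (wt y < wt x) ==> (y \in I)].

Lemma initialP S I : reflect (initial S I) (initialb S I).
Proof.
apply: (iffP andP) => -[sI h]; split=> //.
  by move=> x y xI yS lt; have := forallP (forall_inP h x xI) y; rewrite yS lt.
apply/forall_inP => x xI; apply/forallP => y; apply/implyP => yS; apply/implyP => lt.
exact: h xI yS lt.
Qed.

(* A set that is not initial but has only initial sections differs from an initial segment
   by one swap of two complementary sets that are consecutive in the order. *)
Lemma complementary_swap S x (B := [set z : {set 'I_m} | (z \subset S) && (wt z < wt x)]) :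
  x \subset S -> wt x < wt (S :\: x) ->
  (forall z, z \subset S -> wt x < wt z -> wt z < wt (S :\: x) -> False) ->
  #|nbh S (x |: B)| <= #|nbh S ((S :\: x) |: B)|.
Proof.
move=> xS xy gap; set y := S :\: x.
have S0 : S != set0 by apply: contraTneq xy => S0; rewrite S0 set0D ltnNge wt0.
have [d [dS dmax]] := max_elt S0.
have inB z : z \subset S -> wt z < wt x -> z \in B by move=> zS h; rewrite inE zS.
have full : nbh S (y |: B) = powerset S -> #|nbh S (x |: B)| <= #|nbh S (y |: B)|.
  by move=> ->; apply: subset_leq_card; exact: nbh_sub.
(* If [x] contains the last coordinate [d], adding [x] to [B] creates no new neighbours: deleting
   [d] from [x], or from any neighbour of [x] outside [B], leads into [B]. *)
have [dx|dx] := boolP (d \in x).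
  rewrite !nbhU; apply: subset_leq_card; apply: subset_trans (subsetUr _ _).
  rewrite subUset subxx andbT; apply/subsetP => z /nbhP[zS [/set1P->|[j jS /set1P fz]]].
    apply/nbhP; split=> //; right; exists d => //; rewrite flip_in //.
    apply: inB; first exact: subset_trans (subsetDl _ _) xS.
    by rewrite [ltnRHS](wtD1 dx) -[ltnLHS]add0n ltn_add2r letter_wt_gt0.
  have {fz} ez : z = flip j x by rewrite -fz flipK.
  have [jx|jx] := boolP (j \in x).
    apply/nbhP; split=> //; left; apply: inB => //; rewrite ez flip_in //.
    by rewrite [ltnRHS](wtD1 jx) -[ltnLHS]add0n ltn_add2r letter_wt_gt0.
  have jd : j < d.
    rewrite ltn_neqAle dmax // andbT; apply: contraNneq jx => /val_inj ->; exact: dx.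
  have dz : d \in z by rewrite ez in_flip dx; case: eqP jd => // ->; rewrite ltnn.
  apply/nbhP; split=> //; right; exists d => //; rewrite flip_in //.
  apply: inB; first exact: subset_trans (subsetDl _ _) zS.
  have := wtD1 dz; rewrite {1}ez flip_notin // wtU1 //.
  by have := letter_wt_lt jd; lia.
(* Otherwise [y] contains [d]. Since no set lies strictly between [x] and [y], the cube is tiny: [S]
   is [[set d]] or has just the elements [f] and [d], and the neighbourhood on the right-hand side
   is the whole cube. *)
have dy : d \in y by rewrite inE dx dS.
have ySx z : z \subset S -> [\/ wt z < wt x, z = x, z = y | wt y < wt z].
  move=> zS; have [h|h|/wt_inj->] := ltngtP (wt z) (wt x); [by constructor 1| |by constructor 2].
  have [h'|h'|/wt_inj->] := ltngtP (wt z) (wt y); [|by constructor 4|by constructor 3].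
  by case: (gap z zS h h').
have := wt_le_card (ltnW xy); rewrite leq_eqVlt => /orP[/eqP c|c]; last first.
  have x0 : x = set0.
    apply/eqP; apply: contraT => /set0Pn[l lx].
    have ld : l < d.
      rewrite ltn_neqAle dmax ?(subsetP xS) // andbT.
      by apply: contraNneq dx => /val_inj <-.
    have dxl : d \notin x :\ l by rewrite !inE negb_and dx orbT.
    case: (gap (d |: (x :\ l))).
    - by rewrite subUset sub1set dS; apply: subset_trans (subsetDl _ _) xS.
    - by rewrite wtU1 // (wtD1 lx) ltn_add2r letter_wt_lt.
    - apply: wt_card; rewrite cardsU1 dxl; have := cardsD1 l x; rewrite lx !add1n => <-.
      exact: c.
  have SE : S = [set d].
    apply/eqP; rewrite eqEsubset sub1set dS andbT; apply/subsetP => l lS; rewrite inE.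
    apply: contraT => nld; case: (gap [set l]); rewrite ?sub1set //.
      by rewrite x0 wt0 -[[set l]]setU0 wtU1 ?inE // ltn_addr // letter_wt_gt0.
    apply: wt_card; rewrite cards1 /y x0 setD0 (cardsD1 d) dS.
    by rewrite (cardsD1 l) !inE nld lS.
  apply: full; apply/eqP; rewrite eqEsubset nbh_sub; apply/subsetP => z; rewrite powersetE => zS.
  have yE : y = [set d] by rewrite /y x0 setD0.
  apply/nbhP; split=> //; rewrite yE.
  have [dz|dz] := boolP (d \in z).
    left; rewrite !inE; apply/orP; left; rewrite eqEsubset sub1set dz andbT.
    by rewrite SE in zS.
  right; exists d => //; rewrite flip_notin // !inE; apply/orP; left.
  by rewrite eqEsubset subUset subxx sub1set setU11 andbT /=; rewrite SE in zS.
have [f [fx fy ag]] := wt_lexV c xy.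
have fmin l : l \in S -> f <= l.
  move=> lS; rewrite leqNgt; apply/negP => lf.
  by have := ag l lf; rewrite !inE lS andbT; case: (l \in x).
have xE : x = [set f].
  apply/eqP; rewrite eqEsubset sub1set fx andbT; apply/subsetP => j jx; rewrite inE.
  apply: contraT => njf.
  have jy : j \notin y by rewrite inE jx.
  have jd : j < d.
    rewrite ltn_neqAle dmax ?(subsetP xS) // andbT.
    by apply: contraNneq dx => /val_inj <-.
  have dyj : j \notin y :\ d by rewrite !inE negb_and jx orbT.
  have yS : y \subset S by apply: subsetDl.
  have cy : #|j |: (y :\ d)| = #|y| by rewrite cardsU1 dyj [RHS](cardsD1 d) dy.
  case: (gap (j |: (y :\ d))).
  - by rewrite subUset sub1set (subsetP xS) //; apply: subset_trans (subsetDl _ _) yS.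
  - apply: (@wt_lex _ f) => //; first by rewrite c cy.
      by rewrite !inE eq_sym (negbTE njf) fx /= andbF.
    move=> i fi; have iS : i \notin S by apply: contraTN fi => /fmin; rewrite -leqNgt.
    rewrite (contraNF (subsetP xS i) iS); apply/esym; apply: contraNF iS.
    rewrite !inE => /orP[/eqP-> |/and3P[] //]; exact: subsetP xS _ jx.
  - by rewrite -/y (wtD1 dy) wtU1 // ltn_add2r letter_wt_lt.
have yE : y = [set d].
  by apply/esym/eqP; rewrite eqEcard sub1set dy -c xE !cards1.
have SE z : z \subset S -> z :\ f \subset [set d].
  move=> zS; rewrite -yE /y xE; exact: setSD.
apply: full; apply/eqP; rewrite eqEsubset nbh_sub; apply/subsetP => z; rewrite powersetE => zS.
have fS : f \in S by apply: subsetP xS _ fx.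
have zf : z :\ f \in y |: B.
  have := SE z zS; rewrite subset1 yE !in_setU in_set1 => /orP[->//|/eqP->].
  by rewrite inE sub0set wt0 xE -[[set f]]setU0 wtU1 ?inE // ltn_addr ?orbT // letter_wt_gt0.
apply/nbhP; split=> //; have [fz|fz] := boolP (f \in z).
  by right; exists f => //; rewrite flip_in.
by left; rewrite -(setD1_notin fz).
Qed.

Lemma setD_inj S x z : x \subset S -> z \subset S -> S :\: x = S :\: z -> x = z.
Proof.
move=> /subsetP xS /subsetP zS /setP e; apply/setP => i.
have [iS|iS] := boolP (i \in S); last first.
  by rewrite (contraNF (xS i) iS) (contraNF (zS i) iS).
by have := e i; rewrite !inE iS !andbT => /negb_inj.
Qed.

(** Suppose that [x] precedes [y], with [y] in [A] and [x] not. If they agreed at some coordinate of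
    [S], both would lie in one section and contradict its being initial. So they are complementary,
    each determines the other, and there is only one such pair. *)
Lemma initial_of_sections S A : A \subset powerset S ->
  (forall i, i \in S -> initial (S :\ i) (sec0 i A) /\ initial (S :\ i) (sec1 i A)) ->
  ~ initial S A -> exists2 x : {set 'I_m}, x \subset S &
    let B := [set z : {set 'I_m} | (z \subset S) && (wt z < wt x)] in
    [/\ wt x < wt (S :\: x), A = (S :\: x) |: B &
      forall z, z \subset S -> wt x < wt z -> wt z < wt (S :\: x) -> False].
Proof.
move=> sA hsec nA.
have AS z : z \in A -> z \subset S by move=> /(subsetP sA); rewrite powersetE.
have bad x y : x \subset S -> x \notin A -> y \in A -> wt x < wt y -> y = S :\: x.
  move=> xS xA yA lt; apply/setP => i; rewrite inE; have yS := AS y yA.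
  have [iS|iS] := boolP (i \in S); last first.
    by rewrite andbF; apply: contraNF iS => /(subsetP yS).
  rewrite andbT; have [ix|ix] := boolP (i \in x); have [iy|iy] := boolP (i \in y) => //.
    case: (hsec i iS) => _ h.
    have yA1 : y :\ i \in sec1 i A by rewrite !inE eqxx setD1K.
    have := initial_le h yA1 (setSD [set i] xS).
    rewrite !inE eqxx setD1K //= (negbTE xA) => -> //.
    by move: lt; rewrite (wtD1 ix) (wtD1 iy) ltn_add2l => /ltnW.
  case: (hsec i iS) => h _.
  have yA0 : y \in sec0 i A by rewrite !inE yA.
  have xS' : x \subset S :\ i by rewrite subsetD1 xS.
  by have := initial_le h yA0 xS' (ltnW lt); rewrite inE (negbTE xA).
have [x [y [xS xA yA lt]]] : exists x y : {set 'I_m}, [/\ x \subset S, x \notin A, y \in A & wt x < wt y].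
  have [/existsP[x /existsP[y /and4P[]]]|h] := boolP [exists x : {set 'I_m}, exists y : {set 'I_m},
     [&& x \subset S, x \notin A, y \in A & wt x < wt y]]; first by exists x, y.
  case: nA; split=> // y x yA xS lt; apply: contraR h => xA.
  by apply/existsP; exists x; apply/existsP; exists y; rewrite xS xA yA.
have ey := bad x y xS xA yA lt.
exists x => // B; rewrite -ey; split=> //; last first.
  move=> z zS xz zy; have [zA|zA] := boolP (z \in A).
    by move: zy; rewrite (bad x z xS xA zA xz) -ey ltnn.
  have := bad z y zS zA yA zy; rewrite ey => e.
  by rewrite (setD_inj xS zS e) ltnn in xz.
apply/setP => z; rewrite !inE; apply/idP/orP => [zA|[/eqP->//|/andP[zS zx]]].
  have [zx|xz|/wt_inj ezx] := ltngtP (wt z) (wt x); first by right; rewrite AS.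
    by left; rewrite (bad x z xS xA zA xz) -ey.
  by rewrite ezx (negbTE xA) in zA.
apply: contraT => zA; have := bad z y zS zA yA (ltn_trans zx lt); rewrite ey => e.
by rewrite (setD_inj xS zS e) ltnn in zx.
Qed.

(* The compression of A along i; it does not increase the neighbourhood by the inductive
   hypothesis for S :\ i, and it moves A down in the order. *)
Lemma compression S i A : i \in S -> A \subset powerset S ->
  (forall B I, B \subset powerset (S :\ i) -> initial (S :\ i) I -> #|I| = #|B| ->
     #|nbh (S :\ i) I| <= #|nbh (S :\ i) B|) ->
  ~ (initial (S :\ i) (sec0 i A) /\ initial (S :\ i) (sec1 i A)) ->
  exists B, [/\ B \subset powerset S, #|B| = #|A|, #|nbh S B| <= #|nbh S A| &
    \sum_(x in B) wt x < \sum_(x in A) wt x].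
Proof.
move=> iS sA IH nA.
have s0 := sec0_sub i sA; have s1 := sec1_sub i sA.
have [I0 h0 c0] : exists2 I, initial (S :\ i) I & #|I| = #|sec0 i A|.
  by apply: initial_exists; rewrite -card_powerset; exact: subset_leq_card s0.
have [I1 h1 c1] : exists2 I, initial (S :\ i) I & #|I| = #|sec1 i A|.
  by apply: initial_exists; rewrite -card_powerset; exact: subset_leq_card s1.
have sI0 : I0 \subset powerset (S :\ i) by case: h0.
have sI1 : I1 \subset powerset (S :\ i) by case: h1.
have sG : glue i I0 I1 \subset powerset S by apply: glue_sub.
have e0 : sec0 i (glue i I0 I1) = I0 by apply: sec0_glue sI0.
have e1 : sec1 i (glue i I0 I1) = I1 by apply: sec1_glue sI1.
exists (glue i I0 I1); split=> //.
- by rewrite (card_sections i) e0 e1 c0 c1 -card_sections.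
- rewrite (card_nbh_sections iS sG) (card_nbh_sections iS sA) e0 e1.
  rewrite (initial_setU_card (initial_nbh h0) h1) (initial_setU_card (initial_nbh h1) h0).
  rewrite c0 c1; apply: leq_add; rewrite geq_max; apply/andP; split.
  + by apply: leq_trans (IH _ _ s0 h0 c0) _; apply: subset_leq_card; exact: subsetUl.
  + by apply: subset_leq_card; exact: subsetUr.
  + by apply: leq_trans (IH _ _ s1 h1 c1) _; apply: subset_leq_card; exact: subsetUl.
  + by apply: subset_leq_card; exact: subsetUr.
rewrite (sum_wt_sections i (glue i I0 I1)) (sum_wt_sections i A) e0 e1 c1 !addnA ltn_add2r.
have [l0 q0] := initial_sum_le h0 s0 c0; have [l1 q1] := initial_sum_le h1 s1 c1.
rewrite ltn_neqAle leq_add // andbT; apply/negP => /eqP e; apply: nA.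
have /eqP E0 : I0 == sec0 i A.
  by rewrite -q0 eqn_leq l0 /= -(leq_add2r (\sum_(x in I1) wt x)) e leq_add2l.
have /eqP E1 : I1 == sec1 i A.
  by rewrite -q1 eqn_leq l1 /= -(leq_add2l (\sum_(x in I0) wt x)) e leq_add2r.
by rewrite -E0 -E1.
Qed.

(** Outer induction on [#|S|], inner induction on the total weight of [A]. Either some compression
    makes [A] lighter, or all sections are initial and [A] is an initial segment up to a single
    complementary swap. *)
Theorem harper S A I : A \subset powerset S -> initial S I -> #|I| = #|A| ->
  #|nbh S I| <= #|nbh S A|.
Proof.
move: {2}#|S| (leqnn #|S|) => n; elim: n S A I => [|n IHn] S A I cS.
  move=> sA hI c.
  have {}cS : S = set0 by apply/eqP; rewrite -cards_eq0 -leqn0.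
  have -> : I = A; last by [].
  apply/eqP; rewrite eqEcard c leqnn andbT; apply/subsetP => x xI.
  have /set0Pn[y yA] : A != set0 by rewrite -card_gt0 -c card_gt0; apply/set0Pn; exists x.
  have := initial_sub hI xI; rewrite cS subset0 => /eqP->.
  by have := subsetP sA y yA; rewrite powersetE cS subset0 => /eqP <-.
have IH i : i \in S -> forall B J, B \subset powerset (S :\ i) -> initial (S :\ i) J ->
    #|J| = #|B| -> #|nbh (S :\ i) J| <= #|nbh (S :\ i) B|.
  by move=> iS B J; apply: IHn; move: cS; rewrite (cardsD1 i) iS.
move: {2}(\sum_(x in A) wt x) (leqnn (\sum_(x in A) wt x)) => w.
elim: w A => [|w IHw] A.
  move=> w0 sA hI c; have := initial_sum_le hI sA c => -[l e].
  have /eqP-> : I == A by rewrite -e; lia.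
  by [].
move=> wA sA hI c.
have [/existsP[i /andP[iS nsec]]|hsec] :=
  boolP [exists i in S, ~~ (initialb (S :\ i) (sec0 i A) && initialb (S :\ i) (sec1 i A))].
  have [|B [sB cB nB lB]] := compression iS sA (IH i iS).
    by move=> [/initialP h0 /initialP h1]; rewrite h0 h1 in nsec.
  apply: leq_trans (IHw B _ sB hI _) nB; last by rewrite cB.
  by rewrite -ltnS; apply: leq_trans lB wA.
have {}hsec i : i \in S -> initial (S :\ i) (sec0 i A) /\ initial (S :\ i) (sec1 i A).
  move=> iS; move: hsec; rewrite negb_exists => /forallP/(_ i); rewrite iS /= negbK.
  by case/andP => /initialP ? /initialP.
have [/initialP hA|/initialP nA] := boolP (initialb S A); first by rewrite (initial_eq hI hA).
have [x xS [xy EA gap]] := initial_of_sections sA hsec nA.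
have -> : I = x |: [set z : {set 'I_m} | (z \subset S) && (wt z < wt x)].
  apply: (initial_eq hI); last first.
    by rewrite c EA !cardsU1 !inE ltnn andbF /= ltnNge (ltnW xy) andbF.
  split.
    by apply/subsetP => z; rewrite !inE => /orP[/eqP->|/andP[]].
  move=> y z; rewrite !inE => h zS zy; rewrite zS /=.
  by case/orP: h zy => [/eqP->|/andP[_ yx]] zy; rewrite ?zy ?(ltn_trans zy yx) orbT.
rewrite EA; exact: complementary_swap.
Qed.
End HarperTheorem.

(** * Balls and tight initial segments *)

Section Binomials.

Definition binsum n r := \sum_(i < r) 'C(n, i).

Lemma binsumS n r : binsum n r.+1 = binsum n r + 'C(n, r).
Proof. by rewrite /binsum big_ord_recr. Qed.

Lemma binsum0 n : binsum n 0 = 0.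
Proof. by rewrite /binsum big_ord0. Qed.

Lemma bin_step n r : r.*2 < n -> 'C(n, r) <= 'C(n, r.+1).
Proof.
move=> rn; have e := mul_bin_left n r.
rewrite -(@leq_pmul2l r.+1) // e leq_mul2r; apply/orP; right; lia.
Qed.

Lemma bin_mono n r s : r <= s -> s.*2 <= n.+1 -> 'C(n, r) <= 'C(n, s).
Proof.
elim: s => [|s IH]; first by rewrite leqn0 => /eqP->.
rewrite leq_eqVlt => /orP[/eqP->//|rs] sn.
by apply: leq_trans (IH rs _) (bin_step _); lia.
Qed.

Lemma bin_central n r : 'C(n, r) <= 'C(n, n./2).
Proof.
have n2 := odd_double_half n.
have [h|h] := leqP r n./2; first by apply: bin_mono => //; lia.
have [rn|rn] := leqP r n; last by rewrite bin_small.
by rewrite -bin_sub //; apply: bin_mono; lia.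
Qed.

Definition Dsum n := \sum_(0 <= m < n) 'C(m, m./2).

Lemma Dsum0 : Dsum 0 = 0.
Proof. by rewrite /Dsum big_geq. Qed.

Lemma DsumS n : Dsum n.+1 = Dsum n + 'C(n, n./2).
Proof. by rewrite /Dsum big_nat_recr. Qed.

End Binomials.

Section Balls.
Variable m : nat.
Implicit Types (x y z S : {set 'I_m}) (A B I J : {set {set 'I_m}}) (i j d : 'I_m).

(** The inequality is strict: this is the Hamming ball of radius [r - 1], and it is empty for
    [r = 0]. *)
Definition ball S r := [set x : {set 'I_m} | (x \subset S) && (#|x| < r)].

Lemma ballP S r x : (x \in ball S r) = (x \subset S) && (#|x| < r).
Proof. by rewrite inE. Qed.

Lemma ball_sub S r : ball S r \subset powerset S.
Proof. by apply/subsetP => x; rewrite ballP powersetE => /andP[]. Qed.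

Lemma initial_ball S r : initial S (ball S r).
Proof.
split=> [|x y]; first exact: ball_sub.
rewrite !ballP => /andP[_ xr] yS /ltnW/wt_le_card yx.
by rewrite yS (leq_ltn_trans yx xr).
Qed.

Lemma card_ball S r : #|ball S r| = binsum #|S| r.
Proof.
elim: r => [|r IH].
  by rewrite binsum0; apply: eq_card0 => x; rewrite ballP andbF.
rewrite binsumS -IH -(cards_draws S r).
have -> : ball S r.+1 = ball S r :|: [set B : {set 'I_m} | B \subset S & #|B| == r].
  by apply/setP => x; rewrite !inE -andb_orr ltnS leq_eqVlt orbC.
rewrite cardsU; have -> : ball S r :&: [set B : {set 'I_m} | B \subset S & #|B| == r] = set0.
  apply/setP => x; rewrite !inE; case: (x \subset S) => //=.
  by case: ltngtP => //=.
by rewrite cards0 subn0.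
Qed.

Lemma ballS S r s : r <= s -> ball S r \subset ball S s.
Proof.
move=> rs; apply/subsetP => x; rewrite !ballP => /andP[->] /= h.
exact: leq_trans h rs.
Qed.

Lemma nbh_card S A z : z \in nbh S A -> exists2 x, x \in A & #|z| <= #|x|.+1.
Proof.
case/nbhP=> _ [zA|[i iS fz]]; first by exists z.
exists (flip i z) => //; rewrite /flip; case: ifP => iz.
  by rewrite (cardsD1 i z) iz.
by rewrite cardsU1 iz; lia.
Qed.

Lemma nbh_sub_ball S A r : A \subset ball S r -> nbh S A \subset ball S r.+1.
Proof.
move=> /subsetP sA; apply/subsetP => z zN; have [x xA xz] := nbh_card zN.
have := sA x xA; rewrite !ballP => /andP[_ xr].
have := subsetP (nbh_sub S A) z zN; rewrite powersetE => -> /=.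
by rewrite ltnS; exact: leq_trans xz xr.
Qed.

Lemma ball_sub_nbh S I r : initial S I -> I != set0 -> ball S r \subset I ->
  ball S r.+1 \subset nbh S I.
Proof.
move=> hI /set0Pn[x0 x0I] rI; apply/subsetP => z; rewrite ballP => /andP[zS zr].
apply/nbhP; split=> //; have [->|/set0Pn[i iz]] := eqVneq z set0.
  by left; apply: (initial_le hI x0I); rewrite ?sub0set ?wt0.
right; exists i; first exact: subsetP zS _ iz.
apply: (subsetP rI); rewrite flip_in // ballP (subset_trans (subsetDl _ _) zS) /=.
by move: zr; rewrite (cardsD1 i) iz.
Qed.

Definition min_of S i := i \in S /\ forall j, j \in S -> i <= j.

Lemma min_elt S : S != set0 -> exists i, min_of S i.
Proof.
case/set0Pn => i0 i0S; case: (@arg_minnP _ i0 (mem S) val i0S) => i iS imin.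
by exists i.
Qed.

Lemma wt_min_lt S i x y : min_of S i -> x \subset S -> y \subset S -> #|x| = #|y| ->
  i \in x -> i \notin y -> wt x < wt y.
Proof.
move=> [iS imin] xS yS c ix iy; apply: (wt_lex c ix iy) => j ji.
have jS : j \notin S by apply: contraTN ji => /imin; rewrite -leqNgt.
by rewrite (contraNF (subsetP xS j) jS) (contraNF (subsetP yS j) jS).
Qed.

Lemma initial_glue S i B0 B1 : i \in S -> initial (S :\ i) B0 -> initial (S :\ i) B1 ->
  (forall x y, x \in B0 -> y \subset S :\ i -> wt (i |: y) < wt x -> y \in B1) ->
  (forall x y, x \in B1 -> y \subset S :\ i -> wt y < wt (i |: x) -> y \in B0) ->
  initial S (glue i B0 B1).
Proof.
move=> iS h0 h1 h01 h10.
have s0 : B0 \subset powerset (S :\ i) by case: h0.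
have s1 : B1 \subset powerset (S :\ i) by case: h1.
split; first exact: glue_sub.
have n1 := powersetD1_notin s1.
have case_i x : x \subset S -> (i \notin x /\ x \subset S :\ i) \/
   exists y, [/\ i \notin y, y \subset S :\ i & x = i |: y].
  move=> xS; have [ix|ix] := boolP (i \in x); last by left; rewrite subsetD1 xS ix.
  by right; exists (x :\ i); rewrite !inE eqxx setD1K // setSD.
move=> x y xG yS lt.
have xS : x \subset S by have := subsetP (glue_sub iS s0 s1) x xG; rewrite powersetE.
have [[ix xS']|[x' [ix xS' ex]]] := case_i x xS; have [[iy yS']|[y' [iy yS' ey]]] := case_i y yS.
- by move: xG; rewrite !in_glue0 // => xG; apply: (initial_le h0 xG yS' (ltnW lt)).
- by move: xG lt; rewrite ey (in_glue0 _ _ ix) in_glue1 // => xG lt'; exact: h01 xG yS' lt'.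
- by move: xG lt; rewrite ex (in_glue0 _ _ iy) in_glue1 // => xG lt'; exact: h10 xG yS' lt'.
move: xG lt; rewrite ex ey !in_glue1 // !wtU1 // ltn_add2l => xG /ltnW.
exact: (initial_le h1 xG yS').
Qed.

Lemma card_glue S i B0 B1 : B0 \subset powerset (S :\ i) -> B1 \subset powerset (S :\ i) ->
  #|glue i B0 B1| = #|B0| + #|B1|.
Proof.
by move=> s0 s1; rewrite (card_sections i (glue i B0 B1)) (sec0_glue _ s0) (sec1_glue _ s1).
Qed.

Lemma card_nbh_glue S i B0 B1 : i \in S -> B0 \subset powerset (S :\ i) ->
  B1 \subset powerset (S :\ i) -> #|nbh S (glue i B0 B1)| =
  #|nbh (S :\ i) B0 :|: B1| + #|nbh (S :\ i) B1 :|: B0|.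
Proof.
move=> iS s0 s1.
by rewrite (card_nbh_sections iS (glue_sub iS s0 s1)) (sec0_glue _ s0) (sec1_glue _ s1).
Qed.

(* [Dsum #|S|] is the largest vertex boundary of an initial segment ([initial_nbh_le]). *)
Definition tight S r t := exists I, [/\ initial S I, ball S r \subset I, I \subset ball S r.+1,
  #|I| = t /\ 0 < t & t + Dsum #|S| <= #|nbh S I|].

Lemma cardU1_sub S i B0 B1 x : B0 \subset powerset (S :\ i) -> B1 \subset powerset (S :\ i) ->
  x \in glue i B0 B1 -> x \in B0 \/ exists2 y, y \in B1 & x = i |: y /\ #|x| = #|y|.+1.
Proof.
move=> s0 s1; rewrite inE; case: ifP => _; last by left.
case/imsetP => y yB1 ->; right; exists y => //; split=> //.
by rewrite cardsU1 (powersetD1_notin s1).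
Qed.

(** Within a layer the sets containing the smallest coordinate [i] come first, so a full ball
    without [i] and the given segment with [i] form an initial segment. The ball grows by a whole
    layer, which is central by assumption. This matches the recursion [DsumS] exactly. *)
Lemma tight_extend1 S i r t : min_of S i -> tight (S :\ i) r t ->
  'C(#|S :\ i|, r.+1) = 'C(#|S :\ i|, #|S :\ i|./2) ->
  tight S r.+1 (t + binsum #|S :\ i| r.+1).
Proof.
move=> hi [I [hI rI Ir [cI t0] hN]] hC; have iS : i \in S by case: hi.
have sI : I \subset powerset (S :\ i) by case: hI.
have sB := ball_sub (S :\ i) r.+1.
have up x : x \subset S :\ i -> x \subset S by move=> h; apply: subset_trans h (subsetDl _ _).
have upi x : x \subset S :\ i -> i |: x \subset S.
  by move=> h; rewrite subUset sub1set iS up.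
have nix x : x \subset S :\ i -> i \notin x by rewrite subsetD1 => /andP[].
have I0 : I != set0 by rewrite -card_gt0 cI.
exists (glue i (ball (S :\ i) r.+1) I); split.
- apply: initial_glue => //; first exact: initial_ball.
    move=> x y; rewrite ballP => /andP[xS xr] yS /ltnW/wt_le_card.
    rewrite cardsU1 nix // add1n => yx; apply: (subsetP rI); rewrite ballP yS /=.
    by rewrite -ltnS (leq_trans _ xr) // ltnS.
  move=> x y xI yS lt; rewrite ballP yS /=.
  have := subsetP Ir x xI; rewrite ballP => /andP[xS xr].
  have := wt_le_card (ltnW lt); rewrite cardsU1 nix // add1n leq_eqVlt => /orP[/eqP e|h]; last first.
    by apply: leq_trans h xr.
  have c : #|i |: x| = #|y| by rewrite cardsU1 nix.
  have := wt_min_lt hi (upi x xS) (up y yS) c (setU11 _ _) (nix y yS).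
  by move/(ltn_trans lt); rewrite ltnn.
- apply/subsetP => x; rewrite ballP => /andP[xS xr].
  have [ix|ix] := boolP (i \in x); last by rewrite in_glue0 // ballP subsetD1 xS ix.
  rewrite -(setD1K ix) in_glue1 ?inE ?eqxx //; last exact: powersetD1_notin sI.
  by apply: (subsetP rI); rewrite ballP setSD //; move: xr; rewrite (cardsD1 i) ix.
- apply/subsetP => x /(cardU1_sub sB sI) [|[y yI [ex cx]]]; rewrite ballP.
    by move=> /andP[/up xS h]; rewrite ballP xS ltnW.
  by have := subsetP Ir y yI; rewrite ballP cx ex => /andP[/upi-> h].
- by rewrite (card_glue sB sI) card_ball cI addnC; split=> //; lia.
have cS : #|S| = #|S :\ i|.+1 by rewrite (cardsD1 i S) iS.
rewrite (card_nbh_glue iS sB sI) cS DsumS -hC.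
have h1 : binsum #|S :\ i| r.+2 <= #|nbh (S :\ i) (ball (S :\ i) r.+1) :|: I|.
  rewrite -card_ball subset_leq_card //; apply: subset_trans (subsetUl _ _).
  apply: ball_sub_nbh => //; first exact: initial_ball.
  by apply/set0Pn; exists set0; rewrite ballP sub0set cards0.
have h2 : #|nbh (S :\ i) I| <= #|nbh (S :\ i) I :|: ball (S :\ i) r.+1|.
  by rewrite subset_leq_card // subsetUl.
by move: h1; rewrite binsumS; lia.
Qed.

(** The mirror image of [tight_extend1]: here the half with [i] is the ball and the half without [i]
    is the given segment. *)
Lemma tight_extend0 S i r t : min_of S i -> tight (S :\ i) r t ->
  'C(#|S :\ i|, r) = 'C(#|S :\ i|, #|S :\ i|./2) ->
  tight S r (t + binsum #|S :\ i| r).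
Proof.
move=> hi [I [hI rI Ir [cI t0] hN]] hC; have iS : i \in S by case: hi.
have sI : I \subset powerset (S :\ i) by case: hI.
have sB := ball_sub (S :\ i) r.
have up x : x \subset S :\ i -> x \subset S by move=> h; apply: subset_trans h (subsetDl _ _).
have upi x : x \subset S :\ i -> i |: x \subset S.
  by move=> h; rewrite subUset sub1set iS up.
have nix x : x \subset S :\ i -> i \notin x by rewrite subsetD1 => /andP[].
have I0 : I != set0 by rewrite -card_gt0 cI.
exists (glue i I (ball (S :\ i) r)); split.
- apply: initial_glue => //; first exact: initial_ball.
    move=> x y xI yS /ltnW/wt_le_card; have := subsetP Ir x xI; rewrite !ballP => /andP[xS xr].
    by rewrite cardsU1 nix // add1n yS /= => h; rewrite -ltnS (leq_trans _ xr).
  move=> x y; rewrite ballP => /andP[xS xr] yS lt; apply: (subsetP rI); rewrite ballP yS /=.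
  have := wt_le_card (ltnW lt); rewrite cardsU1 nix // add1n leq_eqVlt => /orP[/eqP e|h]; last first.
    by apply: leq_trans h xr.
  have c : #|i |: x| = #|y| by rewrite cardsU1 nix.
  have := wt_min_lt hi (upi x xS) (up y yS) c (setU11 _ _) (nix y yS).
  by move/(ltn_trans lt); rewrite ltnn.
- apply/subsetP => x; rewrite ballP => /andP[xS xr].
  have [ix|ix] := boolP (i \in x); last first.
    by rewrite in_glue0 //; apply: (subsetP rI); rewrite ballP subsetD1 xS ix.
  rewrite -(setD1K ix) in_glue1 ?inE ?eqxx //; last exact: powersetD1_notin sB.
  by rewrite setSD //; move: xr; rewrite (cardsD1 i) ix => /ltnW.
- apply/subsetP => x /(cardU1_sub sI sB) [xI|[y yI [ex cx]]].
    by have := subsetP Ir x xI; rewrite !ballP => /andP[/up-> h].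
  by move: yI; rewrite !ballP cx ex => /andP[/upi-> h].
- by rewrite (card_glue sI sB) card_ball cI; split=> //; lia.
have cS : #|S| = #|S :\ i|.+1 by rewrite (cardsD1 i S) iS.
rewrite (card_nbh_glue iS sI sB) cS DsumS -hC.
have h1 : binsum #|S :\ i| r.+1 <= #|nbh (S :\ i) (ball (S :\ i) r) :|: I|.
  rewrite -card_ball subset_leq_card //.
  case: r rI Ir sB hC => [|r] rI Ir sB hC.
    apply: subset_trans (subsetUr _ _); apply/subsetP => x; rewrite ballP ltnS leqn0 cards_eq0.
    case/andP => _ /eqP->; case/set0Pn: I0 => y yI.
    by apply: (initial_le hI yI); rewrite ?sub0set ?wt0.
  apply: subset_trans (subsetUl _ _).
  apply: ball_sub_nbh => //; first exact: initial_ball.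
  by apply/set0Pn; exists set0; rewrite ballP sub0set cards0.
have h2 : #|nbh (S :\ i) I| <= #|nbh (S :\ i) I :|: ball (S :\ i) r|.
  by rewrite subset_leq_card // subsetUl.
by move: h1; rewrite binsumS; lia.
Qed.

(* The smallest coordinate always splits an initial segment into a ball and an initial segment
   of the smaller cube. *)
Lemma initial_nbh_le S I : initial S I -> #|nbh S I| <= #|I| + Dsum #|S|.
Proof.
move: {2}#|S| (leqnn #|S|) => n; elim: n S I => [|n IHn] S I cS hI.
  have S0 : S = set0 by apply/eqP; rewrite -cards_eq0 -leqn0.
  apply: leq_trans (leq_addr _ _); apply/subset_leq_card/subsetP => z /nbhP[_ []//].
  by case=> i; rewrite S0 inE.
have [->|I0] := eqVneq I set0.
  rewrite (_ : nbh S set0 = set0) ?cards0 //; apply/setP => z; rewrite in_set0.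
  by apply/negP => /nbhP[_ []]; [rewrite inE | case=> i _; rewrite inE].
have [S0|S0] := eqVneq S set0.
  apply: leq_trans (leq_addr _ _); apply/subset_leq_card/subsetP => z /nbhP[_ []//].
  by case=> i; rewrite S0 inE.
have [i hi] := min_elt S0; have iS : i \in S by case: hi.
have cS' : #|S| = #|S :\ i|.+1 by rewrite (cardsD1 i S) iS.
have IH J : initial (S :\ i) J -> #|nbh (S :\ i) J| <= #|J| + Dsum #|S :\ i|.
  by apply: IHn; rewrite -ltnS -cS'.
have sI : I \subset powerset S by case: hI.
have h0 := initial_sec0 i hI; have h1 := initial_sec1 iS hI.
have [x0 x0I x0max] := max_wt I0.
pose r := #|x0|.
have rI : ball S r \subset I.
  apply/subsetP => y; rewrite ballP => /andP[yS yr].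
  by apply: (initial_le hI x0I yS); apply/ltnW/wt_card.
have Ir y : y \in I -> #|y| <= r by move=> /x0max/wt_le_card.
rewrite (card_nbh_sections iS sI) (card_sections i I) cS' DsumS.
have hC := bin_central #|S :\ i| r.
have bS := binsumS #|S :\ i| r; rewrite -!card_ball in bS.
have in1 y : y \in sec1 i I -> #|y| < r.
  by rewrite inE => /andP[iy /Ir]; rewrite cardsU1 iy.
have b0 : ball (S :\ i) r \subset sec0 i I.
  apply/subsetP => y; rewrite ballP subsetD1 inE => /andP[/andP[yS ->] yr].
  by rewrite andbT; apply: (subsetP rI); rewrite ballP yS.
have s1b : sec1 i I \subset ball (S :\ i) r.
  apply/subsetP => y yI; rewrite ballP in1 // andbT.
  exact: initial_sub h1 yI.
(* If some set of the top size [r] in [I] avoids [i], then all sets of size at most [r] with [i]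
   precede it. The half with [i] is then a ball, which grows by one layer, and induction handles the
   other half. *)
have [/existsP[x /and3P[xI /eqP xr ix]]|hx] :=
  boolP [exists x : {set 'I_m}, [&& x \in I, #|x| == r & i \notin x]].
  have -> : sec1 i I = ball (S :\ i) r.
    apply/eqP; rewrite eqEsubset s1b; apply/subsetP => y.
    rewrite ballP subsetD1 inE => /andP[/andP[yS iy] yr]; rewrite iy /=.
    have yS' : i |: y \subset S by rewrite subUset sub1set iS.
    apply: (initial_le hI xI yS').
    have := yr; rewrite leq_eqVlt => /orP[/eqP e|h].
      apply/ltnW; apply: (wt_min_lt hi yS' (initial_sub hI xI) _ _ ix); last by rewrite setU11.
      by rewrite cardsU1 iy xr.
    by apply/ltnW/wt_card; rewrite cardsU1 iy xr.
  have e1 : nbh (S :\ i) (sec0 i I) :|: ball (S :\ i) r = nbh (S :\ i) (sec0 i I).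
    apply/setUidPl; apply: subset_trans b0 _; apply: sub_nbh; by case: h0.
  have e2 : #|nbh (S :\ i) (ball (S :\ i) r) :|: sec0 i I| <= #|ball (S :\ i) r.+1|.
    apply: subset_leq_card; rewrite subUset nbh_sub_ball //=; apply/subsetP => y.
    by rewrite ballP inE => /andP[yI iy]; rewrite subsetD1 (initial_sub hI yI) iy ltnS Ir.
  rewrite e1; apply: leq_trans (leq_add (IH _ h0) e2) _.
  by rewrite bS addnACA !leq_add2l.
(* Otherwise the half without [i] is the ball, and the two halves exchange roles. *)
have e0 : sec0 i I = ball (S :\ i) r.
  apply/eqP; rewrite eqEsubset b0 andbT; apply/subsetP => y yI0.
  rewrite ballP (initial_sub h0 yI0) /=; move: yI0; rewrite inE => /andP[yI iy].
  rewrite ltn_neqAle Ir // andbT; move: hx; rewrite negb_exists => /forallP/(_ y).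
  by rewrite yI iy andbT.
have ix0 : i \in x0.
  by move: hx; rewrite negb_exists => /forallP/(_ x0); rewrite x0I eqxx /= negbK.
have x1 : x0 :\ i \in sec1 i I by rewrite !inE eqxx setD1K.
have r1 : r = #|x0 :\ i|.+1 by rewrite /r (cardsD1 i) ix0.
have e1 : #|nbh (S :\ i) (sec0 i I) :|: sec1 i I| <= #|ball (S :\ i) r.+1|.
  apply: subset_leq_card; rewrite e0 subUset nbh_sub_ball //=.
  by apply: subset_trans s1b (ballS _ _).
have e2 : nbh (S :\ i) (sec1 i I) :|: sec0 i I = nbh (S :\ i) (sec1 i I).
  apply/setUidPl; rewrite e0 r1; apply: ball_sub_nbh => //.
    by apply/set0Pn; exists (x0 :\ i).
  apply/subsetP => y; rewrite ballP subsetD1 => /andP[/andP[yS iy] yr].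
  rewrite inE iy /=; apply: (subsetP rI).
  by rewrite ballP subUset sub1set iS yS cardsU1 iy r1.
rewrite e2; apply: leq_trans (leq_add e1 (IH _ h1)) _.
by rewrite bS e0 addnACA leq_add2l addnC leq_add2l.
Qed.

(** The local LYM inequality, cleared of denominators: the pairs [x \subset z] between the part of
    [I] in layer [r] and its upper shadow are counted twice. Each [x] has [#|S| - r] supersets in
    the shadow, and each [z] has at most [r.+1] subsets of size [r]. *)
Lemma shadow_card S I r : initial S I -> I != set0 -> ball S r \subset I -> I \subset ball S r.+1 ->
  'C(#|S|, r) * binsum #|S| r.+1 + (#|I| - binsum #|S| r) * 'C(#|S|, r.+1) <=
  'C(#|S|, r) * #|nbh S I|.
Proof.
move=> hI I0 rI Ir.
pose L := [set x in I | #|x| == r].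
pose dL := [set z : {set 'I_m} | (z \in nbh S I) && (#|z| == r.+1)].
have cL : #|I| - binsum #|S| r = #|L|.
  rewrite -card_ball -(setIidPr rI) -cardsD; congr #|pred_of_set _|; apply/setP => x.
  rewrite !inE andbC; case xI: (x \in I) => //=; rewrite (initial_sub hI xI) /= -leqNgt.
  have := subsetP Ir x xI; rewrite ballP => /andP[_].
  by rewrite ltnS eqn_leq => ->.
have cN : binsum #|S| r.+1 + #|dL| <= #|nbh S I|.
  rewrite -(cardsID dL (nbh S I)) addnC leq_add //.
    apply: subset_leq_card; apply/subsetP => z; rewrite inE => /andP[zN zr].
    by rewrite in_setI zN inE zN zr.
  rewrite -card_ball; apply: subset_leq_card; apply/subsetP => z zr.
  rewrite inE (subsetP (ball_sub_nbh hI I0 rI)) // andbT inE negb_and.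
  by move: zr; rewrite ballP => /andP[_ zr]; rewrite neq_ltn zr orbT.
have dbl : #|L| * (#|S| - r) <= #|dL| * r.+1.
  have -> : #|L| * (#|S| - r) = \sum_(x in L) (#|S| - r) by rewrite sum_nat_const.
  have -> : #|dL| * r.+1 = \sum_(z in dL) r.+1 by rewrite sum_nat_const.
  apply: (@leq_trans (\sum_(x in L) \sum_(z in dL) (x \subset z))).
    apply: leq_sum => x; rewrite inE => /andP[xI /eqP xr].
    have xS := initial_sub hI xI.
    have -> : #|S| - r = #|S :\: x| by rewrite cardsDS // xr.
    rewrite -(card_in_imset (f := fun i => i |: x)); last first.
      move=> i j; rewrite !inE => /andP[ix _] /andP[jx _] e.
      have : i \in j |: x by rewrite -e setU11.
      by rewrite !inE (negbTE ix) orbF => /eqP.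
    rewrite -big_mkcondr /= sum1_card; apply: subset_leq_card.
    apply/subsetP => z /imsetP[i]; rewrite inE => /andP[ix iS] ->.
    rewrite unfold_in /=; apply/andP; split; last exact: subsetU1.
    rewrite inE cardsU1 ix xr eqxx andbT; apply/nbhP; split.
      by rewrite subUset sub1set iS.
    by right; exists i => //; rewrite flip_in ?setU11 // setU1K.
  rewrite exchange_big /=; apply: leq_sum => z; rewrite inE => /andP[_ /eqP zr].
  rewrite -big_mkcondr /= sum1_card.
  have -> : r.+1 = #|[set x : {set 'I_m} | x \subset z & #|x| == r]|.
    by rewrite cards_draws zr binSn.
  apply: subset_leq_card; apply/subsetP => x; rewrite unfold_in /= => /andP[xL xz].
  by move: xL; rewrite !inE xz => /andP[_ ->].
have e := mul_bin_left #|S| r.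
suff h : #|L| * 'C(#|S|, r.+1) <= 'C(#|S|, r) * #|dL|.
  rewrite cL; apply: leq_trans (leq_mul (leqnn _) cN).
  by rewrite mulnDr leq_add2l.
rewrite -(@leq_pmul2l r.+1) // mulnCA e.
have := leq_mul (leqnn 'C(#|S|, r)) dbl; lia.
Qed.

End Balls.

(** * Ratios of binomial sums and expansion of arbitrary families *)

Section MoreBinomials.

Lemma binsum_full n : binsum n n.+1 = 2 ^ n.
Proof.
rewrite -[2]/(1 + 1) expnDn /binsum; apply: eq_bigr => i _.
by rewrite !exp1n !muln1.
Qed.

Lemma binsum_compl n r s : r + s = n.+1 -> binsum n r + binsum n s = 2 ^ n.
Proof.
elim: r s => [|r IH] s; first by rewrite add0n => ->; rewrite binsum0 binsum_full.
rewrite addSn => -[e]; have := IH s.+1; rewrite addnS e => /(_ erefl).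
rewrite !binsumS; suff -> : 'C(n, s) = 'C(n, r) by lia.
by rewrite -bin_sub; [congr 'C(_, _) | ]; lia.
Qed.

Lemma binsum_mono n r s : r <= s -> binsum n r <= binsum n s.
Proof.
elim: s => [|s IH]; first by rewrite leqn0 => /eqP->.
by rewrite leq_eqVlt => /orP[/eqP->//|/IH h]; rewrite binsumS; apply: leq_trans h (leq_addr _ _).
Qed.

Lemma bin_middle n r s : r <= s -> s <= n - r -> 'C(n, r) <= 'C(n, s).
Proof.
move=> rs sn; have [h|h] := leqP s.*2 n; first by apply: bin_mono => //; lia.
by rewrite -[leqRHS]bin_sub; [apply: bin_mono|]; lia.
Qed.

Lemma bin_log_concave n i j : j <= i -> 'C(n, i.+1) * 'C(n, j) <= 'C(n, i) * 'C(n, j.+1).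
Proof.
move=> ji; have [ni|ni] := leqP i n; last by rewrite (@bin_small n i.+1) // ltnW.
have ei := mul_bin_left n i; have ej := mul_bin_left n j.
have [e|jn] := eqVneq j n.
  by rewrite (@bin_small n i.+1) //; lia.
have pos : 0 < i.+1 * (n - j) by rewrite muln_gt0 /= subn_gt0; lia.
rewrite -(leq_pmul2l pos).
have -> : i.+1 * (n - j) * ('C(n, i.+1) * 'C(n, j)) =
          (n - i) * j.+1 * ('C(n, i) * 'C(n, j.+1)).
  by rewrite mulnACA ei -ej mulnACA [_ * j.+1]mulnC; lia.
by apply: leq_mul => //; rewrite mulnC; apply: leq_mul; lia.
Qed.

Lemma binsum_ratio n r : 'C(n, r.+1) * binsum n r <= 'C(n, r) * binsum n r.+1.
Proof.
rewrite /binsum big_ord_recl mulnDr /=; apply: leq_trans (leq_addl _ _).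
rewrite !big_distrr /=; apply: leq_sum => i _.
exact/bin_log_concave/ltnW/ltn_ord.
Qed.

(** The ratio of ['C(n, r)] to [binsum n r] does not increase with [r], so the bound at [R] descends
    to smaller radii. *)
Lemma binsum_linear n P E R : E * binsum n R <= P * 'C(n, R) -> R <= n ->
  forall r, r <= R -> E * binsum n r <= P * 'C(n, r).
Proof.
elim: R => [|R IH] hR Rn r; first by rewrite leqn0 => /eqP->.
rewrite leq_eqVlt => /orP[/eqP->//|]; rewrite ltnS => rR; apply: IH rR; last by lia.
have c0 : 0 < 'C(n, R.+1) by rewrite bin_gt0.
rewrite -(leq_pmul2l c0); have := binsum_ratio n R.
have b0 : 0 < 'C(n, R) by rewrite bin_gt0 ltnW.
move=> h; apply: (@leq_trans (E * ('C(n, R) * binsum n R.+1))).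
  by rewrite mulnCA leq_mul2l h orbT.
by have := leq_mul (leqnn 'C(n, R)) hR; lia.
Qed.

End MoreBinomials.

Section Expansion.
Variable m : nat.
Implicit Types (x y z S : {set 'I_m}) (A B I J : {set {set 'I_m}}) (i j d : 'I_m).

(** A larger family contains one of exactly [t] elements, to which Harper's theorem applies. The
    surplus of [A] over [t] is given away. *)
Lemma tight_expansion S r t A : tight S r t -> A \subset powerset S -> t <= #|A| ->
  t + Dsum #|S| <= #|nbh S A|.
Proof.
move=> [I [hI _ _ [cI _] hN]] sA tA.
have [B sBA cB] : exists2 B : {set {set 'I_m}}, B \subset A & #|B| = t.
  exists [set x in take t (enum A)].
    by apply/subsetP => x; rewrite inE => /mem_take; rewrite mem_enum.
  rewrite cardsE (card_uniqP _); last exact: take_uniq (enum_uniq _).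
  by rewrite size_takel // -cardE.
apply: leq_trans (leq_trans hN (harper (subset_trans sBA sA) hI _)) _.
  by rewrite cI cB.
exact: subset_leq_card (nbhS _ sBA).
Qed.

(** By Harper's theorem [A] may be taken as an initial segment with top layer [r]. If [r < R], its
    ball and its partial layer both expand at the linear rate. Otherwise having at most half of the
    cube forces [r < #|S| - R]. The boundary is then at least a weighted mean of the layers [r] and
    [r.+1], both no smaller than layer [R]. *)
Lemma layer_expansion S R P E A : R.*2 < #|S| -> E * binsum #|S| R <= P * 'C(#|S|, R) ->
  A \subset powerset S -> (#|A|).*2 <= 2 ^ #|S| ->
  'C(#|S|, R) + #|A| <= #|nbh S A| \/ (E + P) * #|A| <= P * #|nbh S A|.
Proof.
move=> hR hE sA cA.
have [->|A0] := eqVneq A set0; first by right; rewrite cards0 muln0.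
have cAS : #|A| <= 2 ^ #|S| by lia.
have [I hI cI] := initial_exists cAS.
have hN := harper sA hI cI.
suff : 'C(#|S|, R) + #|I| <= #|nbh S I| \/ (E + P) * #|I| <= P * #|nbh S I|.
  rewrite -cI => -[h|h]; [left; exact: leq_trans h hN | right].
  by apply: leq_trans h _; rewrite leq_mul2l hN orbT.
have I0 : I != set0 by rewrite -card_gt0 cI card_gt0.
have [x0 x0I x0max] := max_wt I0.
pose r := #|x0|.
have rI : ball S r \subset I.
  apply/subsetP => y; rewrite ballP => /andP[yS yr].
  by apply: (initial_le hI x0I yS); apply/ltnW/wt_card.
have Ir : I \subset ball S r.+1.
  apply/subsetP => y yI; rewrite ballP (initial_sub hI yI) ltnS /=.
  exact/wt_le_card/x0max.
have := shadow_card hI I0 rI Ir.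
have lr : binsum #|S| r < #|I|.
  rewrite -card_ball; apply: proper_card; apply/properP; split=> //.
  by exists x0 => //; rewrite ballP ltnn andbF.
have ur : #|I| <= binsum #|S| r + 'C(#|S|, r).
  by rewrite -binsumS -card_ball; apply: subset_leq_card.
rewrite binsumS -cI in cA *.
move: (#|nbh S I|) (#|I|) (#|S|) lr ur hR hE cA => N z n lr ur hR hE cA.
have [l ez] : exists l, z = binsum n r + l by exists (z - binsum n r); lia.
have lc : l <= 'C(n, r) by lia.
rewrite {}ez in lr ur cA *; rewrite addKn => hN'.
have [rn|rn] := leqP r n; last first.
  by move: lr lc; rewrite bin_small //; lia.
have c0 : 0 < 'C(n, r) by rewrite bin_gt0.
have [rR|rR] := ltnP r R.
  right; rewrite -(leq_pmul2l c0).
  have Rn : R <= n by lia.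
  have h1 := binsum_linear hE Rn (ltnW rR); have h2 := binsum_linear hE Rn rR.
  rewrite binsumS in h2.
  have [g eg] : exists g, 'C(n, r) = l + g by exists ('C(n, r) - l); lia.
  move: h1 h2 hN' c0; rewrite eg.
  move: (binsum n r) ('C(n, r.+1)) => b c h1 h2 hN' c0.
  rewrite [leqRHS]mulnCA; apply: leq_trans (leq_mul (leqnn P) hN').
  have := leq_mul (leqnn l) h2; have := leq_mul (leqnn g) h1.
  rewrite !mulnDr !mulnDl; nia.
left; rewrite -(leq_pmul2l c0).
have rnR : r < n - R.
  rewrite ltnNge; apply/negP => h; have := binsum_mono n h.
  have := @binsum_compl n (n - R) R.+1; have := @binsum_mono n R.+1 (n - R); lia.
have h1 : 'C(n, R) <= 'C(n, r) by apply: bin_middle => //; lia.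
have h2 : 'C(n, R) <= 'C(n, r.+1) by apply: bin_middle => //; lia.
move: h1 h2 hN' lc; move: ('C(n, r)) ('C(n, r.+1)) ('C(n, R)) (binsum n r) => a c e b h1 h2 hN' lc.
apply: leq_trans hN'; rewrite !mulnDr; nia.
Qed.

End Expansion.

(** * Sizes at which the vertex boundary is maximal *)

Section Sequences.

Lemma bin_double_succ j : 'C(j.*2.+1, j.+1) = 'C(j.*2, j) + 'C(j.*2, j.+1).
Proof. by rewrite binS addnC. Qed.

Lemma bin_double_succ' j : 'C(j.*2.+1, j) = 'C(j.*2, j) + 'C(j.*2, j.+1).
Proof. by rewrite -bin_double_succ -bin_sub; [congr 'C(_, _) | ]; lia. Qed.

Lemma bin_doubleS j : 'C(j.+1.*2, j.+1) = ('C(j.*2, j) + 'C(j.*2, j.+1)).*2.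
Proof. by rewrite doubleS binS bin_double_succ bin_double_succ' addnn. Qed.

Lemma bin_catalan j : j.+1 * 'C(j.*2, j.+1) = j * 'C(j.*2, j).
Proof. by rewrite mul_bin_left; congr (_ * _); lia. Qed.

Lemma expn2_doubleS j : 2 ^ j.+1.*2 = 4 * 2 ^ j.*2.
Proof. by rewrite doubleS !expnS mulnA. Qed.

(* [catdefect N./2] is the difference [q - p] of the two sizes in [parameters]. *)
Definition catdefect j := 1 + \sum_(i < j) 'C(i.*2, i.+1).

Lemma catdefectS j : catdefect j.+1 = catdefect j + 'C(j.*2, j.+1).
Proof. by rewrite /catdefect big_ord_recr addnA. Qed.

Lemma Dsum_doubleS j : Dsum j.+1.*2 = Dsum j.*2 + ('C(j.*2, j)).*2 + 'C(j.*2, j.+1).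
Proof.
rewrite doubleS !DsumS doubleK /= uphalf_double bin_double_succ'; lia.
Qed.

Lemma Dsum_catdefect j : 3 * catdefect j + Dsum j.*2 = ('C(j.*2, j)).*2.+1.
Proof.
elim: j => [|j IH]; first by rewrite /catdefect big_ord0 Dsum0.
by rewrite catdefectS Dsum_doubleS bin_doubleS; lia.
Qed.

Lemma binsum_double j : (binsum j.*2 j).*2 + 'C(j.*2, j) = 2 ^ j.*2.
Proof. by rewrite -(@binsum_compl j.*2 j j.+1) ?binsumS; lia. Qed.

Lemma binsum_double_succ j : binsum j.*2.+1 j.+1 = 2 ^ j.*2.
Proof.
have := @binsum_compl j.*2.+1 j.+1 j.+1; rewrite expnS; lia.
Qed.

Lemma bin_le_binsum j : 'C(j.*2, j.+1) <= binsum j.*2 j.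
Proof.
case: j => [|j]; first by rewrite bin_small.
have -> : 'C(j.+1.*2, j.+2) = 'C(j.+1.*2, j).
  by rewrite -bin_sub; [congr 'C(_, _) | ]; lia.
by rewrite binsumS leq_addl.
Qed.

Lemma tight_start m (S : {set 'I_m}) : #|S| = 0 -> tight S 0 1.
Proof.
move=> S0; exists (ball S 1); split.
- exact: initial_ball.
- exact: ballS.
- by [].
- by rewrite card_ball S0 binsumS binsum0.
rewrite S0 Dsum0 (leq_trans _ (subset_leq_card (sub_nbh (ball_sub S 1)))) //.
by rewrite card_ball S0 binsumS binsum0.
Qed.

(** The dimension grows by [tight_extend0] from even to odd and by [tight_extend1] from odd to even,
    so the layer gained is always a central one. *)
Lemma tight_max j :
  (forall m (S : {set 'I_m}), #|S| = j.*2 -> tight S j (binsum j.*2 j + catdefect j)) /\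
  (forall m (S : {set 'I_m}), #|S| = j.*2.+1 ->
     tight S j (binsum j.*2 j + catdefect j + binsum j.*2 j)).
Proof.
have odd_of_even i :
  (forall m (S : {set 'I_m}), #|S| = i.*2 -> tight S i (binsum i.*2 i + catdefect i)) ->
  forall m (S : {set 'I_m}), #|S| = i.*2.+1 ->
     tight S i (binsum i.*2 i + catdefect i + binsum i.*2 i).
  move=> H m S cS; have [d hd] : exists d, min_of S d.
    by apply: min_elt; rewrite -card_gt0 cS.
  have cS' : #|S :\ d| = i.*2 by have := cardsD1 d S; rewrite (proj1 hd) cS => -[].
  by have := @tight_extend0 m S d i _ hd (H m _ cS'); rewrite cS' doubleK; apply.
elim: j => [|j [_ IH]].
  have E : forall m (S : {set 'I_m}), #|S| = 0.*2 -> tight S 0 (binsum 0.*2 0 + catdefect 0).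
    by move=> m S /tight_start; rewrite binsum0 /catdefect big_ord0.
  by split=> //; exact: odd_of_even E.
have E : forall m (S : {set 'I_m}), #|S| = j.+1.*2 ->
    tight S j.+1 (binsum j.+1.*2 j.+1 + catdefect j.+1).
  move=> m S cS; have [d hd] : exists d, min_of S d.
    by apply: min_elt; rewrite -card_gt0 cS.
  have cS' : #|S :\ d| = j.*2.+1 by have := cardsD1 d S; rewrite (proj1 hd) cS doubleS => -[].
  have := @tight_extend1 m S d j _ hd (IH m _ cS').
  rewrite cS' /= uphalf_double bin_double_succ bin_double_succ' => /(_ erefl).
  rewrite binsum_double_succ catdefectS.
  suff -> : binsum j.*2 j + catdefect j + binsum j.*2 j + 2 ^ j.*2 =
            binsum j.+1.*2 j.+1 + (catdefect j + 'C(j.*2, j.+1)) by [].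
  have := binsum_double j; have := binsum_double j.+1; rewrite bin_doubleS expn2_doubleS; lia.
by split=> //; exact: odd_of_even E.
Qed.

(** The last step uses the lower of the two central layers of dimension [j.*2.+1], whereas
    [tight_max] uses the upper one. By [Dsum_catdefect] the resulting size satisfies
    [p.*2 + catdefect j.+1 = M - D + 1], where [M] and [D] are the power of two and the [Dsum] of
    the new dimension. *)
Lemma tight_balanced_even j m (S : {set 'I_m}) p : #|S| = j.+1.*2 ->
  p.*2 + ('C(j.+1.*2, j.+1)).*2 = 2 ^ j.+1.*2 + (catdefect j.+1).*2 -> tight S j p.
Proof.
move=> cS ep; have [d hd] : exists d, min_of S d.
  by apply: min_elt; rewrite -card_gt0 cS.
have cS' : #|S :\ d| = j.*2.+1 by have := cardsD1 d S; rewrite (proj1 hd) cS doubleS => -[].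
have := @tight_extend0 m S d j _ hd (proj2 (tight_max j) m _ cS').
rewrite cS' /= uphalf_double => /(_ erefl).
suff -> : binsum j.*2 j + catdefect j + binsum j.*2 j + binsum j.*2.+1 j = p by [].
have := binsum_double j; have := binsum_double_succ j; rewrite binsumS bin_double_succ'.
move: ep; rewrite bin_doubleS expn2_doubleS catdefectS; lia.
Qed.

Lemma tight_balanced_odd j m (S : {set 'I_m}) p : #|S| = j.+1.*2.+1 ->
  p.*2 + 3 * 'C(j.+1.*2, j.+1) = (2 ^ j.+1.*2).*2 + (catdefect j.+1).*2 -> tight S j.+1 p.
Proof.
move=> cS ep; have [d hd] : exists d, min_of S d.
  by apply: min_elt; rewrite -card_gt0 cS.
have cS' : #|S :\ d| = j.+1.*2 by have := cardsD1 d S; rewrite (proj1 hd) cS => -[].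
have e := binsum_double j.+1.
have ble : 'C(j.+1.*2, j.+1) <= 2 ^ j.+1.*2 by lia.
have [p' ep'] : exists p', p'.*2 + ('C(j.+1.*2, j.+1)).*2 = 2 ^ j.+1.*2 + (catdefect j.+1).*2.
  exists (p - binsum j.+1.*2 j.+1).
  have : binsum j.+1.*2 j.+1 <= p.
    move: ep; rewrite bin_doubleS expn2_doubleS catdefectS => ep.
    have := binsum_double j.+1; rewrite bin_doubleS expn2_doubleS.
    have := binsum_double j; have := bin_le_binsum j; lia.
  lia.
have := @tight_extend1 m S d j _ hd (tight_balanced_even cS' ep').
rewrite cS' doubleK => /(_ erefl).
by suff -> : p' + binsum j.+1.*2 j.+1 = p by []; lia.
Qed.

End Sequences.

(** * The sizes p and q and the inequalities they satisfy *)

Section BalancedSizes.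

(** The input of [no_majority]. The first two bounds keep [q] close to [D]; the third says that a
    window of length [2 * q] starting at position [p + q] still fits. *)
Definition small_gap M D p q := [/\ q < D + 2, D < q + 4 & 2 * (p + q) + (q - p) <= 2 * M].

(** The input of [no_balanced_ends]. The first bound makes the signs balanced on squares. The radius
    [R] is for [layer_expansion] in dimension [N.+1], with [2 * p + 2] and [2 * D - 1] as the
    parameters of the linear rate; the bound on [M] excludes its other alternative. *)
Definition large_dim N M D p q := 2 * M <= 3 * (p + q) /\ exists R, [/\ R.*2 < N.+1,
  M <= 'C(N.+1, R) + p.*2.+1 & (2 * D - 1) * binsum N.+1 R <= (2 * p + 2) * 'C(N.+1, R)].

(* With b = 'C(2j,j), kap the j-th Catalan number, and s the sum of the previous ones. *)
Lemma catalan_facts j : exists kap s, [/\ 'C(j.*2, j) = kap * j.+1, 'C(j.*2, j.+1) = kap * j,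
  Dsum j.*2 + 1 = 'C(j.*2, j) + s, 3 * catdefect j + s = 'C(j.*2, j) + 2 &
  7 <= j -> [/\ s.*2 <= kap, 6 * 2 ^ j.*2 <= (4 * j + 2) * 'C(j.*2, j) &
     4 * 'C(j.*2, j) <= 2 ^ j.*2]].
Proof.
elim: j => [|j [kap [s [eb eu eD ex H]]]].
  by exists 1, 0; split=> //; rewrite ?Dsum0 ?/catdefect ?big_ord0.
have e1 := bin_doubleS j; have e2 := bin_catalan j.+1.
have [kap' ek'] : exists kap', 'C(j.+1.*2, j.+1) = kap' * j.+2.
  exists ('C(j.+1.*2, j.+1) - 'C(j.+1.*2, j.+2)).
  have : 'C(j.+1.*2, j.+2) <= 'C(j.+1.*2, j.+1) by nia.
  move: e2; nia.
have eu' : 'C(j.+1.*2, j.+2) = kap' * j.+1 by move: e2; rewrite ek'; nia.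
have ekk : kap' * j.+2 = kap * (4 * j + 2) by move: e1; rewrite ek' eb eu; lia.
exists kap', (s + kap); split=> //.
- by rewrite Dsum_doubleS e1 eb eu; move: eD; rewrite eb; lia.
- by rewrite catdefectS e1 eb eu; move: ex; rewrite eb; lia.
(* The inequalities start at 7, where they are checked numerically, and then propagate by the
   Catalan recursion [ekk]. *)
rewrite leq_eqVlt => /orP[/eqP [ej]|j7].
  rewrite -ej in eb eD ek' *.
  have k6 : kap = 132.
    have : 'C(6.*2, 6) = 132 * 7 by vm_compute.
    by rewrite eb; lia.
  have k7 : kap' = 429.
    have : 'C(7.*2, 7) = 429 * 8 by vm_compute.
    by rewrite ek'; lia.
  have D6 : Dsum 6.*2 = 988 by rewrite !DsumS Dsum0; vm_compute.
  split.
  - by move: eD; rewrite D6 eb k6 k7; lia.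
  - have -> : 2 ^ 7.*2 = 128 * 128 by rewrite -[7.*2]/(7 + 7) expnD.
    by rewrite ek' k7; lia.
  - have -> : 2 ^ 7.*2 = 128 * 128 by rewrite -[7.*2]/(7 + 7) expnD.
    by rewrite ek' k7; lia.
have [h1 h2 h3] := H j7.
split.
- have : 3 * kap <= kap' by nia.
  lia.
- rewrite expn2_doubleS ek' ekk; move: h2; rewrite eb; nia.
- rewrite expn2_doubleS ek' ekk; move: h3; rewrite eb; nia.
Qed.

(** The nonlinear core of [large_dim_even], with [Q] the power of two, [b] and [u] the two
    binomials, [x] the value of [catdefect] and [beta] the ball size. The equations are multiplied
    by suitable variables beforehand, so that the goal is linear in the products. *)
Lemma large_even_arith p kap s Q D b u beta x : p.*2 + b.*2 = Q + x.*2 -> D + 1 = b + s ->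
  3 * x + s = b + 2 -> u + kap = b -> 3 * Q * (kap + 2 * s) <= (2 * b - kap) * (2 * b) ->
  beta + (b + u) = Q -> (2 * D - 1) * beta <= (2 * p + 2) * (b + u).
Proof.
move=> ep eD ex hu; have [A eA] : exists A, A = b + u by exists (b + u).
have -> : 2 * b - kap = A by lia.
rewrite -eA => hQ eQ.
have e1 := congr1 (muln^~ beta) eD; have e2 := congr1 (muln b) eQ.
have e3 := congr1 (muln s) eQ; have e4 := congr1 (muln A) ep; have e5 := congr1 (muln A) ex.
have e6 : A * Q + kap * Q = 2 * b * Q by rewrite -mulnDl; congr (_ * _); lia.
rewrite /= in e1 e2 e3 e4 e5.
rewrite mulnBl mul1n; lia.
Qed.

(** The radius is [R = j]. From 7 on, [kap] is at most an eighth of the central binomial and [s] at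
    most half of [kap]; the cases 4, 5 and 6 are numerical. *)
Lemma large_dim_even j p : 4 <= j ->
  p.*2 + ('C(j.*2, j)).*2 = 2 ^ j.*2 + (catdefect j).*2 ->
  large_dim j.*2 (2 ^ j.*2) (Dsum j.*2) p (2 ^ j.*2 - Dsum j.*2 + 1 - p).
Proof.
move=> j4 ep; have [kap [s [eb eu eD ex H]]] := catalan_facts j.
have eA := bin_double_succ' j; have ebs := binsum_double_succ j; rewrite binsumS in ebs.
suff [h1 [h2 h3]] : 3 * Dsum j.*2 <= 2 ^ j.*2 + 3 /\
  (2 ^ j.*2 <= 'C(j.*2.+1, j) + p.*2.+1 /\
   (2 * Dsum j.*2 - 1) * binsum j.*2.+1 j <= (2 * p + 2) * 'C(j.*2.+1, j)).
  by split; [lia | exists j; split=> //; lia].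
rewrite eA in ebs *.
have [j7|j7] := leqP 7 j.
  have [hs hQ hb] := H j7.
  have hk : 8 * kap <= 'C(j.*2, j) by rewrite eb; nia.
  split; first by lia.
  split; first by lia.
  have hu : 'C(j.*2, j.+1) + kap = 'C(j.*2, j) by rewrite eb eu; lia.
  have hQ2 : 3 * 2 ^ j.*2 * (kap + 2 * s) <= (2 * 'C(j.*2, j) - kap) * (2 * 'C(j.*2, j)).
    apply: (@leq_trans (3 * 2 ^ j.*2 * (2 * kap))).
      by rewrite leq_mul2l; lia.
    have -> : 2 * 'C(j.*2, j) - kap = kap * (2 * j + 1) by rewrite eb; lia.
    move: hQ; nia.
  move: ep eD ex hu hQ2 ebs; clear.
  move: (2 ^ _) (Dsum _) ('C(_, j)) ('C(_, j.+1)) (binsum _ _) (catdefect _).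
  exact: large_even_arith.
have : [|| j == 4, j == 5 | j == 6] by lia.
case/or3P => /eqP ej; rewrite {}ej {eb eu H} in ep eD ex eA ebs *.
- have vb : 'C(4.*2, 4) = 70 by vm_compute.
  have vu : 'C(4.*2, 5) = 56 by vm_compute.
  have vQ : 2 ^ 4.*2 = 256 by vm_compute.
  have vD : Dsum 4.*2 = 78 by rewrite !DsumS Dsum0; vm_compute.
  rewrite vb vu vQ vD in ep eD ex ebs *.
  have vp : p = 79 by lia.
  have vB : binsum 4.*2.+1 4 = 130 by lia.
  by rewrite vp vB.
- have vb : 'C(5.*2, 5) = 252 by vm_compute.
  have vu : 'C(5.*2, 6) = 210 by vm_compute.
  have vQ : 2 ^ 5.*2 = 1024 by vm_compute.
  have vD : Dsum 5.*2 = 274 by rewrite !DsumS Dsum0; vm_compute.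
  rewrite vb vu vQ vD in ep eD ex ebs *.
  have vp : p = 337 by lia.
  have vB : binsum 5.*2.+1 5 = 562 by lia.
  rewrite vp vB; lia.
have vb : 'C(6.*2, 6) = 924 by vm_compute.
have vu : 'C(6.*2, 7) = 792 by vm_compute.
have vQ : 2 ^ 6.*2 = 4096 by vm_compute.
have vD : Dsum 6.*2 = 988 by rewrite !DsumS Dsum0; vm_compute.
rewrite vb vu vQ vD in ep eD ex ebs *.
have vp : p = 1411 by lia.
have vB : binsum 6.*2.+1 6 = 2380 by lia.
rewrite vp vB; lia.
Qed.

Lemma large_odd_arith p kap s Q D b u A beta x : p.*2 + 3 * b = Q.*2 + x.*2 -> D + 1 = 2 * b + s ->
  u + kap = b -> 2 * s <= kap -> 8 * kap <= b -> 4 * b <= A + 6 * kap ->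
  3 * (Q * kap) <= 2 * (b * b) ->
  8 <= b -> beta + A + (b + u) = Q.*2 -> (2 * D - 1) * beta <= (2 * p + 2) * A.
Proof.
move=> ep eD hu hs hk hA hQ b8 eQ.
have e1 := congr1 (muln^~ beta) eD; have e2 := congr1 (muln b) eQ.
have e3 := congr1 (muln s) eQ; have e4 := congr1 (muln A) ep.
have e5 := leq_mul hA (leqnn Q).
have e6 := leq_mul hs (leqnn Q).
have e7 : b * (4 * b) <= b * (A + 6 * kap) by rewrite leq_mul2l hA orbT.
have e8 : b * (8 * kap) <= b * b by rewrite leq_mul2l hk orbT.
have e9 : b * (u + kap) = b * b by rewrite hu.
have b3 : 8 * b <= b * b by rewrite leq_mul2r b8 orbT.
have e10 : 8 * A <= b * A by rewrite leq_mul2r b8 orbT.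
rewrite /= in e1 e2 e3 e4 e5 e6.
have p1 : 0 <= s * A by []. have p2 : 0 <= x * A by [].
have p3 : 0 <= s * b by []. have p4 : 0 <= s * u by [].
rewrite mulnBl mul1n; lia.
Qed.

Lemma bin_sub2 j : 'C(j.+1.*2, j) = 'C(j.+1.*2, j.+2).
Proof. by rewrite -bin_sub; [congr 'C(_, _) | ]; lia. Qed.

Lemma large_dim_odd j p : 3 <= j ->
  p.*2 + 3 * 'C(j.*2, j) = (2 ^ j.*2).*2 + (catdefect j).*2 ->
  large_dim j.*2.+1 (2 ^ j.*2.+1) (Dsum j.*2.+1) p (2 ^ j.*2.+1 - Dsum j.*2.+1 + 1 - p).
Proof.
move=> j3 ep; have [kap [s [eb eu eD ex H]]] := catalan_facts j.
have [kap' [_ [eb' eu' _ _ _]]] := catalan_facts j.+1.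
rewrite -bin_sub2 in eu'.
have eb2 := bin_doubleS j.
have ebs : binsum j.*2.+2 j + 'C(j.*2.+2, j) + ('C(j.*2, j) + 'C(j.*2, j.+1)) = (2 ^ j.*2).*2.
  have := binsum_double j.+1; rewrite binsumS expn2_doubleS eb2 doubleS; lia.
have eDs : Dsum j.*2.+1 = Dsum j.*2 + 'C(j.*2, j) by rewrite DsumS doubleK.
suff [h1 [h2 h3]] : 3 * Dsum j.*2.+1 <= (2 ^ j.*2).*2 + 3 /\
  ((2 ^ j.*2).*2 <= 'C(j.*2.+2, j) + p.*2.+1 /\
   (2 * Dsum j.*2.+1 - 1) * binsum j.*2.+2 j <= (2 * p + 2) * 'C(j.*2.+2, j)).
  rewrite /large_dim expnS; split; [lia | exists j; split=> //; lia].
rewrite eDs; rewrite doubleS in eu' eb'.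
have [j7|j7] := leqP 7 j.
  have [hs hQ hb] := H j7.
  have hk : 8 * kap <= 'C(j.*2, j) by rewrite eb; nia.
  have hu : 'C(j.*2, j.+1) + kap = 'C(j.*2, j) by rewrite eb eu; lia.
  have hkk : kap' <= 4 * kap.
    have : kap' * j.+2 = kap * (4 * j + 2) by move: eb2; rewrite doubleS eb' eb eu; lia.
    nia.
  have hA : 4 * 'C(j.*2, j) <= 'C(j.*2.+2, j) + 6 * kap.
    by move: eb2; rewrite doubleS eu' eb'; lia.
  have hQ2 : 3 * (2 ^ j.*2 * kap) <= 2 * ('C(j.*2, j) * 'C(j.*2, j)).
    have : 3 * 2 ^ j.*2 * kap <= (2 * j + 1) * 'C(j.*2, j) * kap.
      by rewrite leq_mul2r; apply/orP; right; lia.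
    have : kap * (2 * j + 1) <= 2 * 'C(j.*2, j) by rewrite eb; lia.
    move=> h1 h2; have := leq_mul (leqnn 'C(j.*2, j)) h1; lia.
  split; first by lia.
  split; first by lia.
  have b8 : 8 <= 'C(j.*2, j).
    have : 0 < 'C(j.*2, j) by rewrite bin_gt0; lia.
    by rewrite {1}eb muln_gt0 => /andP[k0 _]; lia.
  by apply: (large_odd_arith (s := s)) ep _ hu _ hk hA hQ2 b8 ebs; lia.
have : [|| j == 3, j == 4, j == 5 | j == 6] by lia.
case/or4P => /eqP ej; rewrite {}ej {eb eu H eb2 eb' eu'} in ep eD ex eDs ebs *.
- have vb : 'C(3.*2, 3) = 20 by vm_compute.
  have vu : 'C(3.*2, 4) = 15 by vm_compute.
  have vQ : 2 ^ 3.*2 = 64 by vm_compute.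
  have vA : 'C(3.*2.+2, 3) = 56 by vm_compute.
  have vD : Dsum 3.*2 = 23 by rewrite !DsumS Dsum0; vm_compute.
  rewrite vb vu vQ vD vA in ep eD ex ebs *.
  have vp : p = 40 by lia.
  have vB : binsum 3.*2.+2 3 = 37 by lia.
  rewrite vp vB; lia.
- have vb : 'C(4.*2, 4) = 70 by vm_compute.
  have vu : 'C(4.*2, 5) = 56 by vm_compute.
  have vQ : 2 ^ 4.*2 = 256 by vm_compute.
  have vA : 'C(4.*2.+2, 4) = 210 by vm_compute.
  have vD : Dsum 4.*2 = 78 by rewrite !DsumS Dsum0; vm_compute.
  rewrite vb vu vQ vD vA in ep eD ex ebs *.
  have vp : p = 172 by lia.
  have vB : binsum 4.*2.+2 4 = 176 by lia.
  rewrite vp vB; lia.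
- have vb : 'C(5.*2, 5) = 252 by vm_compute.
  have vu : 'C(5.*2, 6) = 210 by vm_compute.
  have vQ : 2 ^ 5.*2 = 1024 by vm_compute.
  have vA : 'C(5.*2.+2, 5) = 792 by vm_compute.
  have vD : Dsum 5.*2 = 274 by rewrite !DsumS Dsum0; vm_compute.
  rewrite vb vu vQ vD vA in ep eD ex ebs *.
  have vp : p = 723 by lia.
  have vB : binsum 5.*2.+2 5 = 794 by lia.
  rewrite vp vB; lia.
have vb : 'C(6.*2, 6) = 924 by vm_compute.
have vu : 'C(6.*2, 7) = 792 by vm_compute.
have vQ : 2 ^ 6.*2 = 4096 by vm_compute.
have vA : 'C(6.*2.+2, 6) = 3003 by vm_compute.
have vD : Dsum 6.*2 = 988 by rewrite !DsumS Dsum0; vm_compute.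
rewrite vb vu vQ vD vA in ep eD ex ebs *.
have vp : p = 2997 by lia.
have vB : binsum 6.*2.+2 6 = 3473 by lia.
rewrite vp vB; lia.
Qed.

(** The three alternatives are established for [N] at most 3, for [N] from 4 to 6 and for [N] at
    least 7, respectively. *)
Lemma parameters N : exists p q, [/\ p + q = 2 ^ N - Dsum N + 1, Dsum N <= 2 ^ N, p <= q,
  (forall m (S : {set 'I_m}), #|S| = N -> exists r, tight S r p) &
  q <= p.+1 \/ small_gap (2 ^ N) (Dsum N) p q \/ large_dim N (2 ^ N) (Dsum N) p q].
Proof.
rewrite -(odd_double_half N); case: (odd N); case: (N./2) => {N} [|j]; rewrite ?add0n ?add1n.
- exists 1, 1; rewrite DsumS Dsum0; split=> //; last by left.
  move=> m S cS; exists 0; have := proj2 (tight_max 0) m S cS.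
  by rewrite binsum0 /catdefect big_ord0.
- have [p ep] : exists p, p.*2 + 3 * 'C(j.+1.*2, j.+1) = (2 ^ j.+1.*2).*2 + (catdefect j.+1).*2.
    exists (2 ^ j.+1.*2 + catdefect j.+1 - 3 * ('C(j.*2, j) + 'C(j.*2, j.+1))).
    rewrite bin_doubleS expn2_doubleS catdefectS.
    have := binsum_double j; have := bin_le_binsum j; lia.
  have eDx := Dsum_catdefect j.+1.
  have eDs : Dsum j.+1.*2.+1 = Dsum j.+1.*2 + 'C(j.+1.*2, j.+1) by rewrite DsumS doubleK.
  have eM : 2 ^ j.+1.*2.+1 = (2 ^ j.+1.*2).*2 by rewrite expnS mul2n.
  have hb : Dsum j.+1.*2.+1 <= 2 ^ j.+1.*2.+1.
    move: eDx; rewrite eDs eM bin_doubleS expn2_doubleS catdefectS.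
    have := binsum_double j; have := bin_le_binsum j; lia.
  exists p, (p + catdefect j.+1); split=> //; first by lia.
  + exact: leq_addr.
  + by move=> m S cS; exists j.+1; exact: tight_balanced_odd cS ep.
  have [j3|j3] := leqP 3 j.+1.
    right; right; have := large_dim_odd j3 ep.
    by have -> : 2 ^ j.+1.*2.+1 - Dsum j.+1.*2.+1 + 1 - p = p + catdefect j.+1 by lia.
  have /orP[/eqP e|/eqP e] : (j == 0) || (j == 1) by lia.
    left; have vx : catdefect 1 = 1 by rewrite /catdefect big_ord_recr big_ord0.
    by rewrite e vx addn1.
  right; left; rewrite e in ep eDx eDs eM *.
  have vb : 'C(2.*2, 2) = 6 by vm_compute.
  have vx : catdefect 2 = 2 by rewrite /catdefect !big_ord_recr big_ord0.
  have vQ : 2 ^ 2.*2 = 16 by [].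
  by rewrite vb vx vQ in ep eDx eDs eM *; rewrite /small_gap eDs eM; split; lia.
- exists 1, 1; rewrite Dsum0; split=> //; last by left.
  by move=> m S cS; exists 0; exact: tight_start.
have [p ep] : exists p, p.*2 + ('C(j.+1.*2, j.+1)).*2 = 2 ^ j.+1.*2 + (catdefect j.+1).*2.
  exists (2 * 2 ^ j.*2 + catdefect j.+1 - 2 * ('C(j.*2, j) + 'C(j.*2, j.+1))).
  rewrite bin_doubleS expn2_doubleS catdefectS.
  have := binsum_double j; have := bin_le_binsum j; lia.
have eDx := Dsum_catdefect j.+1.
have hb : Dsum j.+1.*2 <= 2 ^ j.+1.*2.
  move: eDx; rewrite bin_doubleS expn2_doubleS catdefectS.
  have : 0 < catdefect j by [].
  have := binsum_double j; have := bin_le_binsum j; lia.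
exists p, (p + catdefect j.+1); split=> //; first by lia.
- exact: leq_addr.
- by move=> m S cS; exists j; exact: tight_balanced_even cS ep.
have [j4|j4] := leqP 4 j.+1.
  right; right; have := large_dim_even j4 ep.
  by have -> : 2 ^ j.+1.*2 - Dsum j.+1.*2 + 1 - p = p + catdefect j.+1 by lia.
have /or3P[/eqP e|/eqP e|/eqP e] : [|| j == 0, j == 1 | j == 2] by lia.
- left; have vx : catdefect 1 = 1 by rewrite /catdefect big_ord_recr big_ord0.
    by rewrite e vx addn1.
- right; left; rewrite e in ep eDx *.
  have vb : 'C(2.*2, 2) = 6 by vm_compute.
  have vx : catdefect 2 = 2 by rewrite /catdefect !big_ord_recr big_ord0.
  have vQ : 2 ^ 2.*2 = 16 by [].
  by rewrite vb vx vQ in ep eDx *; rewrite /small_gap; split; lia.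
right; left; rewrite e in ep eDx *.
have vb : 'C(3.*2, 3) = 20 by vm_compute.
have vx : catdefect 3 = 6 by rewrite /catdefect !big_ord_recr big_ord0.
have vQ : 2 ^ 3.*2 = 64 by [].
by rewrite vb vx vQ in ep eDx *; rewrite /small_gap; split; lia.
Qed.

End BalancedSizes.

(** * Even and odd vertices along a numbering *)

Section TwoColourings.
Variables (M k p q : nat).
Implicit Types E O : nat -> nat.

(* E x and O x count the even and the odd vertices at positions < x. *)
Definition counting E O := [/\ forall x, x <= 2 * M -> E x + O x = x,
  forall x y, x <= y -> E x <= E y, forall x y, x <= y -> O x <= O y &
  E (2 * M) = M /\ O (2 * M) = M].

(* No two positions in [a, b) and [c, d) are k or more apart, so [p] even vertices in the
   first interval and [q] odd vertices in the second cannot be joined by an edge. *)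
Definition crossing E O := forall a b c d, b <= 2 * M -> d <= 2 * M -> b <= c + k -> d <= a + k ->
  E a + p <= E b -> O c + q <= O d -> False.

Lemma counting_swap E O : counting E O -> counting O E.
Proof. by case=> s mE mO [e o]; split=> // x /s; rewrite addnC. Qed.

Lemma counting_step E O x : counting E O -> x < 2 * M -> E x.+1 <= (E x).+1.
Proof.
move=> [s _ mO _] xM; have := s x (ltnW xM); have := s x.+1 xM; have := mO x x.+1 (leqnSn x); lia.
Qed.

Lemma counting_ivt E O x y t : counting E O -> x <= y -> y <= 2 * M -> E x <= t -> t <= E y ->
  exists2 z, x <= z <= y & E z = t.
Proof.
move=> cnt; elim: y => [|y IH] xy yM Ex Ey.
  have x0 : x = 0 by lia.
  by exists 0; [lia | move: Ex Ey; rewrite x0; lia].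
have [tE|tE] := leqP t (E y).
  have [xy'|xy'] := leqP x y.
    by have [z hz ez] := IH xy' (ltnW yM) Ex tE; exists z; lia.
  have exy : x = y.+1 by lia.
  by exists x; [lia | move: Ex Ey; rewrite exy; lia].
exists y.+1; first by lia.
have := counting_step cnt yM; lia.
Qed.

Hypotheses (pq : p <= q) (ek : p + q = k) (kM : k <= 2 * M).

(* The potential 2 (E x + E (x + k)) - (2 x + k) is positive at every x: shrink the window [x, x + k)
   on the right until it holds exactly q even vertices, and compare with x shifted by the same amount. *)
Lemma no_even_windows E O : counting E O -> crossing O E ->
  (forall x, x + k <= 2 * M -> E x + q < E (x + k)) -> False.
Proof.
move=> cnt cross win; have [s mE mO [eM oM]] := cnt.
have O0 : O 0 = 0 by have := s 0 (leq0n _); lia.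
have pot x : x + k <= 2 * M -> 2 * x + k < 2 * (E x + E (x + k)).
  have [n] := ubnP x; elim: n x => // n IH x xn xM.
  have w := win x xM.
  have [|y /andP[xy yk] ey] := @counting_ivt E O x (x + k) (E x + q) cnt (leq_addr _ _) xM (leq_addr _ _).
    exact: ltnW.
  have sx := s x; have sxk := s (x + k) xM; have sy := s y.
  have [cx|cx] := leqP (x + k - y) x.
    have yE : y = x - (x + k - y) + k by lia.
    have h : O (x + k) < O (x - (x + k - y)) + p.
      rewrite ltnNge; apply/negP => h.
      by apply: (cross (x - (x + k - y)) (x + k) x y); rewrite ?ey //; lia.
    have cpos : 0 < x + k - y.
      rewrite subn_gt0 ltn_neqAle yk andbT; apply/eqP => eyx.
      by move: w; rewrite -ey eyx ltnn.
    have := IH (x - (x + k - y)); rewrite -yE => /(_ _ _).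
    have sc := s (x - (x + k - y)).
    move: (x - (x + k - y)) yE h sc => z yE h sc H.
    have {}H := H ltac:(lia) ltac:(lia).
    have := mO z x; lia.
  (* Here the shifted window would start before position 0, and the interval from 0 to [x + k] takes
     its place. *)
  have h : O (x + k) < p.
    rewrite ltnNge; apply/negP => h; apply: (cross 0 (x + k) x y); rewrite ?O0 ?ey //; lia.
  lia.
(* At the last window the potential demands [2 * E (2 * M - k) > 2 * M - k]. The window itself has
   more than [q] of the [M] even vertices, which leaves fewer than [M - q], and [2 * q >= k]. *)
have := pot (2 * M - k); rewrite subnK // eM => /(_ (leqnn _)).
have := win (2 * M - k); rewrite subnK // eM => /(_ (leqnn _)); lia.
Qed.

(** A window never has exactly [p] or exactly [q] even vertices, and sliding it by one changes this
    number by at most one. So the number stays below [p], between [p] and [q], or above [q]; below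
    [p] means more than [q] odd vertices. *)
Lemma window_trichotomy E O : counting E O -> crossing E O -> crossing O E ->
  [\/ forall x, x + k <= 2 * M -> E x + q < E (x + k),
      forall x, x + k <= 2 * M -> O x + q < O (x + k) |
      forall x, x + k <= 2 * M ->
        [/\ E x + p < E (x + k), E (x + k) < E x + q, O x + p < O (x + k) & O (x + k) < O x + q]].
Proof.
move=> cnt c1 c2; have [s mE mO _] := cnt; have cnt' := counting_swap cnt.
have np x : x + k <= 2 * M -> E (x + k) != E x + p.
  move=> xM; apply/eqP => e; have sx := s x (leq_trans (leq_addr k x) xM); have sk := s (x + k) xM.
  by apply: (c1 x (x + k) x (x + k)) => //; lia.
have nq x : x + k <= 2 * M -> E (x + k) != E x + q.
  move=> xM; apply/eqP => e; have sx := s x (leq_trans (leq_addr k x) xM); have sk := s (x + k) xM.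
  by apply: (c2 x (x + k) x (x + k)) => //; lia.
have step x : x.+1 + k <= 2 * M ->
   E (x.+1 + k) + E x <= (E (x + k) + E x.+1).+1 /\ E (x + k) + E x.+1 <= (E (x.+1 + k) + E x).+1.
  move=> xM; have := @counting_step E O x cnt; have := @counting_step E O (x + k) cnt.
  rewrite addSn; have := mE x x.+1 (leqnSn x); have := mE (x + k) (x + k).+1 (leqnSn _); lia.
have k0 : 0 + k <= 2 * M by [].
have := np 0 k0; have := nq 0 k0 => nq0 np0.
have ind (P : nat -> Prop) : P 0 -> (forall x, x.+1 + k <= 2 * M -> P x -> P x.+1) ->
    forall x, x + k <= 2 * M -> P x.
  move=> P0 PS; elim=> // x IH xM; apply: (PS x xM); apply: IH; lia.
have [hp|hp] := ltnP (E (0 + k)) (E 0 + p).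
  constructor 2.
  have H : forall x, x + k <= 2 * M -> E (x + k) < E x + p.
    by apply: ind => // x xM; have := np x.+1 xM; have := step x xM; lia.
  by move=> x xM; have := H x xM; have := s x (leq_trans (leq_addr k x) xM); have := s (x + k) xM; lia.
have [hq|hq] := ltnP (E 0 + q) (E (0 + k)).
  constructor 1.
  by apply: ind => // x xM; have := nq x.+1 xM; have := step x xM; lia.
constructor 3.
have H : forall x, x + k <= 2 * M -> E x + p < E (x + k) /\ E (x + k) < E x + q.
  apply: ind; first by lia.
  by move=> x xM; have := np x.+1 xM; have := nq x.+1 xM; have := step x xM; lia.
by move=> x xM; have := H x xM; have := s x (leq_trans (leq_addr k x) xM); have := s (x + k) xM; split; lia.
Qed.

Definition majority E t :=
  E (t + (q - p)) + p < E (t + (q - p) + 2 * p) /\ E t + q < E (t + 2 * q).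

(** The outer window at the left end and the inner window right after it put at least [k + 2] even
    vertices before position [2 * k]. The outer window at the right end leaves at most [M - q - 1]
    before [2 * M - 2 * q]. Whichever position comes first, monotonicity of [E] or of [O]
    contradicts [small_gap]. *)
Lemma no_majority E O D : counting E O -> k + D = M + 1 -> small_gap M D p q ->
  (forall t, t + 2 * q <= 2 * M -> majority E t) -> False.
Proof.
move=> [s mE mO [eM oM]] kD [qD Dq hM] maj.
have [_ h0] : majority E 0 by apply: maj; lia.
have [_ h1] : majority E (2 * M - 2 * q) by apply: maj; lia.
have [h2 _] : majority E (2 * q - (q - p)) by apply: maj; lia.
rewrite add0n in h0; rewrite subnK ?eM in h1; last by lia.
rewrite subnK in h2; last by lia.
have := s (2 * q + 2 * p); have := s (2 * M - 2 * q).
have := mE (2 * q + 2 * p) (2 * M - 2 * q); have := mO (2 * M - 2 * q) (2 * q + 2 * p).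
have := s 0; lia.
Qed.

(** Concentric windows of lengths [2 * p] and [2 * q] are just short enough for [crossing]: [p]
    vertices of one colour in the inner one leave fewer than [q] of the other in the outer one. So
    one colour has the majority in both. It cannot change in one step, because the count in the
    inner window would have to jump by two. *)
Lemma no_middle_windows E O D : counting E O -> crossing E O -> crossing O E ->
  k + D = M + 1 -> small_gap M D p q -> False.
Proof.
move=> cnt c1 c2 kD sg; have [s mE mO _] := cnt; have cnt' := counting_swap cnt.
have [_ _ hM] := sg.
have maj t : t + 2 * q <= 2 * M -> majority E t \/ majority O t.
  move=> tM; have := s t; have := s (t + 2 * q) tM.
  have := s (t + (q - p)); have := s (t + (q - p) + 2 * p) => s1 s2 s3 s4.
  have := c1 (t + (q - p)) (t + (q - p) + 2 * p) t (t + 2 * q).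
  have := c2 (t + (q - p)) (t + (q - p) + 2 * p) t (t + 2 * q).
  rewrite /majority => h1 h2.
  have [e|e] := leqP (E (t + (q - p)) + p) (E (t + (q - p) + 2 * p)).
    left; have : O (t + 2 * q) < O t + q.
      by rewrite ltnNge; apply/negP => h; apply: h2 => //; lia.
    have [o|o] := leqP (O (t + (q - p)) + p) (O (t + (q - p) + 2 * p)).
      have : E (t + 2 * q) < E t + q.
        by rewrite ltnNge; apply/negP => h; apply: h1 => //; lia.
      lia.
    lia.
  right; have : E (t + 2 * q) < E t + q.
    by rewrite ltnNge; apply/negP => h; apply: h1 => //; lia.
  lia.
have step t : t.+1 + 2 * q <= 2 * M -> majority E t -> majority O t.+1 -> False.
  rewrite /majority !addSn => tM [a _] [b _].
  have := @counting_step O E (t + (q - p) + 2 * p) cnt'.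
  have := s (t + (q - p)); have := s (t + (q - p) + 2 * p).
  have := s (t + (q - p)).+1; have := s (t + (q - p) + 2 * p).+1.
  have := mE (t + (q - p) + 2 * p) _ (leqnSn _); have := mO (t + (q - p)) _ (leqnSn _); lia.
have step' t : t.+1 + 2 * q <= 2 * M -> majority O t -> majority E t.+1 -> False.
  rewrite /majority !addSn => tM [a _] [b _].
  have := s (t + (q - p)); have := s (t + (q - p) + 2 * p).
  have := s (t + (q - p)).+1; have := s (t + (q - p) + 2 * p).+1.
  have := mO (t + (q - p) + 2 * p) _ (leqnSn _); have := mE (t + (q - p)) _ (leqnSn _); lia.
have [h0|h0] := maj 0 ltac:(lia).
  apply: (no_majority cnt kD sg); elim=> // t IH tM.
  have ht := IH ltac:(lia); have [//|h] := maj _ tM; case: (step t tM ht h).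
apply: (no_majority cnt' kD sg); elim=> // t IH tM.
have ht := IH ltac:(lia); have [h|//] := maj _ tM; case: (step' t tM ht h).
Qed.

End TwoColourings.

(** * Signs of edges *)

Section Positions.
Variables (n : nat) (pos : {set 'I_n} -> nat).
Hypothesis pos_inj : injective pos.
Hypothesis pos_lt : forall x, pos x < 2 ^ n.

Lemma card_cube : #|{set 'I_n}| = 2 ^ n.
Proof. by rewrite -cardsT -powersetT card_powerset cardsT card_ord. Qed.

Lemma card_pos_lt t : t <= 2 ^ n -> #|[set x | pos x < t]| = t.
Proof.
move=> tn; pose f x := Ordinal (pos_lt x).
have fI : injective f by move=> x y [] /pos_inj.
have fB : bijective f by apply: inj_card_bij fI _; rewrite card_ord card_cube.
have -> : [set x | pos x < t] = f @^-1: [set i : 'I_(2 ^ n) | i < t].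
  by apply/setP => x; rewrite !inE.
rewrite on_card_preimset; last exact: onW_bij.
rewrite -sum1_card; under eq_bigl => i do rewrite inE.
by rewrite -(big_ord_widen _ (fun=> 1) tn) sum1_card card_ord.
Qed.

End Positions.

Section EdgeSigns.
Variables (n k : nat) (pos : {set 'I_n} -> nat).
Implicit Types (x y z S : {set 'I_n}) (i j : 'I_n) (e : bool).
Hypothesis pos_lt : forall x, pos x < 2 ^ n.
Hypothesis pos_gap : forall i x, pos x + k <= pos (flip i x) \/ pos (flip i x) + k <= pos x.
Hypothesis k_gt0 : 0 < k.
Hypothesis k_large : 2 ^ n <= 3 * k.

(** Changing the endpoint reverses both the direction along the numbering and the parity, so the
    sign belongs to the edge ([sgn_flip]). *)
Definition sgn x i := (pos x < pos (flip i x)) (+) odd #|x|.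

Lemma odd_flip i x : odd #|flip i x| = ~~ odd #|x|.
Proof.
rewrite /flip; case: ifP => ix; last by rewrite cardsU1 ix.
by rewrite (cardsD1 i x) ix /= negbK.
Qed.

Lemma sgn_flip x i : sgn (flip i x) i = sgn x i.
Proof.
rewrite /sgn flipK odd_flip; have := pos_gap i x => h.
have -> : (pos (flip i x) < pos x) = ~~ (pos x < pos (flip i x)) by lia.
by case: (pos x < _); case: odd.
Qed.

(* Around a square the signs cancel: otherwise its four vertices would be met in monotone
   order, and would spread over at least 3 k + 1 > 2 ^ n positions. *)
Lemma sgn_square x i j : sgn x i (+) sgn (flip i x) j = sgn x j (+) sgn (flip j x) i.
Proof.
rewrite /sgn !odd_flip [flip i (flip j x)]flipC.
have := pos_gap i x; have := pos_gap j x; have := pos_gap j (flip i x).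
have := pos_gap i (flip j x); rewrite [flip i (flip j x)]flipC.
have := pos_lt x; have := pos_lt (flip i x); have := pos_lt (flip j x).
have := pos_lt (flip j (flip i x)).
move: (pos x) (pos (flip i x)) (pos (flip j x)) (pos (flip j (flip i x))) => a b c d.
case: (odd #|x|) => /=; case: (ltnP a b); case: (ltnP b d); case: (ltnP a c); case: (ltnP c d);
  rewrite ?addbT ?addbF //=; lia.
Qed.

Lemma flipD1 i j x : i != j -> flip i (x :\ j) = flip i x :\ j.
Proof.
move=> ij; apply/setP => l; rewrite in_flip !inE in_flip.
by case: (eqVneq l j) => [->|] //=; rewrite eq_sym (negbTE ij).
Qed.

(** Integration one coordinate at a time: [gam] is extended across the edges in direction [i0], and
    [sgn_square] makes the result consistent with the edges in the other directions. *)
Lemma sgn_potential S : exists gam : {set 'I_n} -> bool, forall x i, x \subset S -> i \in S ->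
  gam x (+) gam (flip i x) = sgn x i.
Proof.
move: {2}#|S| (leqnn #|S|) => c; elim: c S => [|c IH] S cS.
  have -> : S = set0 by apply/eqP; rewrite -cards_eq0 -leqn0.
  by exists (fun=> false) => x i _; rewrite inE.
have [->|/set0Pn[i0 i0S]] := eqVneq S set0.
  by exists (fun=> false) => x i _; rewrite inE.
have [|gam hg] := IH (S :\ i0); first by move: cS; rewrite (cardsD1 i0) i0S.
exists (fun x => if i0 \in x then gam (x :\ i0) (+) sgn x i0 else gam x) => x i xS iS.
have [->|ni] := eqVneq i i0.
  rewrite in_flip eqxx; have [ix|ix] := boolP (i0 \in x) => /=.
    by rewrite flip_in // [gam _ (+) _]addbC addbK.
  by rewrite flip_notin // setU1K // addKb -flip_notin // sgn_flip.
have iS' : i \in S :\ i0 by rewrite !inE ni.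
rewrite flip_id_notin //; have [ix|ix] := boolP (i0 \in x); last first.
  by apply: hg => //; rewrite subsetD1 xS.
rewrite -flipD1 //; have := hg (x :\ i0) i (setSD _ xS) iS'.
have := sgn_square (x :\ i0) i i0.
have -> : sgn (flip i (x :\ i0)) i0 = sgn (flip i x) i0.
  rewrite -[RHS]sgn_flip flipD1 // [flip i0 (flip i x)]flip_in //.
  by rewrite flip_id_notin.
have -> : sgn (x :\ i0) i0 = sgn x i0 by rewrite -flip_in // sgn_flip.
have -> : flip i0 (x :\ i0) = x by rewrite -flip_in // flipK.
by case: (gam _); case: (gam _); case: (sgn _ _); case: (sgn _ _); case: (sgn _ _); case: (sgn _ _).
Qed.

Variable gam : {set 'I_n} -> bool.
Hypothesis gamE : forall x i, gam x (+) gam (flip i x) = sgn x i.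

(* [wall e] separates [side e true] from [side e false]. *)
Definition wall e := [set x : {set 'I_n} | (odd #|x| == e) &&
  [exists i, exists j, gam (flip i x) != gam (flip j x)]].
Definition side e b := [set x : {set 'I_n} |
  if odd #|x| == e then [forall i, gam (flip i x) == b] else gam x == b].

(** Let [z] have a neighbour in the side. If [z] has parity [e], that neighbour has value [b], so
    the neighbours of [z] either all have value [b] or take both values. If not, [z] is itself among
    the neighbours required to have value [b]. *)
Lemma nbh_side e b : nbh setT (side e b) \subset side e b :|: wall e.
Proof.
apply/subsetP => z /nbhP[_ [zb|[i _]]]; rewrite in_setU; first by rewrite zb.
rewrite [in X in X -> _]inE odd_flip; have [oz|oz] := boolP (odd #|z| == e).
  have -> : (~~ odd #|z| == e) = false by move: oz; case: odd; case: e.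
  move=> /eqP gb; apply/orP; have [h|h] := boolP [forall j, gam (flip j z) == b].
    by left; rewrite inE oz.
  right; rewrite inE oz /=; apply/existsP; exists i; move: h; rewrite negb_forall.
  by case/existsP => j h; apply/existsP; exists j; rewrite gb eq_sym.
have -> : (~~ odd #|z| == e) by move: oz; case: odd; case: e.
by move=> /forallP/(_ i); rewrite flipK => gz; rewrite inE (negbTE oz) gz.
Qed.

Lemma card_nbh_side e b : #|nbh setT (side e b)| <= #|side e b| + #|wall e|.
Proof.
apply: leq_trans (subset_leq_card (nbh_side e b)) _.
by rewrite cardsU leq_subr.
Qed.

Lemma small_side e (i : 'I_n) : exists b : bool, (#|side e b|).*2 <= 2 ^ n.
Proof.
have ub : #|side e true| + #|side e false| <= 2 ^ n.
  rewrite -[n in 2 ^ n]card_ord -cardsT -card_powerset powersetT -cardsUI.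
  have -> : side e true :&: side e false = set0.
    apply/setP => x; rewrite !inE; case: (odd #|x| == e); last by case: (gam x).
    by apply/negP => /andP[/forallP/(_ i)/eqP h1 /forallP/(_ i)]; rewrite h1.
  by rewrite cards0 addn0 subset_leq_card // subsetT.
have [h|/ltnW h] := leqP #|side e true| #|side e false|; [exists true | exists false];
  by rewrite -addnn; apply: leq_trans ub; rewrite ?leq_add2l ?leq_add2r.
Qed.

Definition early := [set x | pos x < k].
Definition late := [set x | 2 ^ n - k <= pos x].

(** There is no room for a neighbour [k] positions lower, so all edges at such a vertex lead
    upwards. *)
Lemma sgn_early x i : x \in early -> sgn x i = ~~ odd #|x|.
Proof.
rewrite inE => xk; rewrite /sgn; have h := pos_gap i x.
by have -> : pos x < pos (flip i x) by lia.
Qed.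

Lemma sgn_late x i : x \in late -> sgn x i = odd #|x|.
Proof.
rewrite inE => xk; rewrite /sgn; have h := pos_gap i x; have := pos_lt (flip i x) => h'.
by have -> : pos x < pos (flip i x) = false by lia.
Qed.

Lemma wall_middle e x : x \in wall e -> x \notin early :|: late.
Proof.
rewrite inE => /andP[_ /existsP[i /existsP[j h]]]; apply: contra h.
have : sgn x i = sgn x j -> gam (flip i x) == gam (flip j x).
  by rewrite -!gamE => /addbI->.
by move=> hs; rewrite in_setU => /orP[h|h]; apply: hs; rewrite ?(sgn_early _ h) ?(sgn_late _ h).
Qed.

(* The vertices near the two ends of the numbering whose edges all have sign [t]. *)
Definition extreme t := [set x in early | odd #|x| != t] :|: [set x in late | odd #|x| == t].

(** All neighbours of an extreme vertex have the value [gam x (+) t]. The choice of [t] makes the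
    conditions for the two sides complementary: where one fails, the other holds. *)
Lemma extreme_sides b0 b1 : extreme (~~ (b0 (+) b1)) \subset side false b0 :|: side true b1.
Proof.
set t := ~~ _.
have key x : (forall i, gam x (+) gam (flip i x) = t) -> x \in side false b0 :|: side true b1.
  move=> h; have gf i : gam (flip i x) = gam x (+) t by rewrite -(h i) addKb.
  have all c : gam x (+) t = c -> [forall i, gam (flip i x) == c].
    by move=> <-; apply/forallP => i; rewrite gf.
  rewrite !inE; case ox: (odd #|x|) => /=.
    have [//|nb] := eqVneq (gam x) b0; rewrite all ?orbT //.
    by move: nb; rewrite /t; case: (gam x); case: (b0); case: (b1).
  have [_|nb] := eqVneq (gam x) b1; first by rewrite orbT.
  by rewrite all //; move: nb; rewrite /t; case: (gam x); case: (b0); case: (b1).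
apply/subsetP => x; rewrite in_setU => /orP[]; rewrite inE => /andP[xe ox]; apply: key => i;
  rewrite gamE ?(sgn_early _ xe) ?(sgn_late _ xe); move: ox; by case: odd; case: t.
Qed.

End EdgeSigns.

Section Parity.
Variable n : nat.
Hypothesis n_gt0 : 0 < n.

Lemma card_parity (e : bool) : #|[set x : {set 'I_n} | odd #|x| == e]| = 2 ^ n.-1.
Proof.
pose i := Ordinal n_gt0.
have flipE : [set x : {set 'I_n} | odd #|x| == ~~ e] =
    [set flip i x | x in [set x : {set 'I_n} | odd #|x| == e]].
  apply/setP => x; rewrite inE; apply/idP/imsetP => [ox|[y]].
    by exists (flip i x); rewrite ?flipK // inE odd_flip; move: ox; case: odd; case: e.
  by rewrite inE => oy ->; rewrite odd_flip; move: oy; case: odd; case: e.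
have c : #|[set x : {set 'I_n} | odd #|x| == ~~ e]| = #|[set x : {set 'I_n} | odd #|x| == e]|.
  by rewrite flipE card_imset //; exact: can_inj (flipK i).
have : #|[set x : {set 'I_n} | odd #|x| == e]| + #|[set x : {set 'I_n} | odd #|x| == ~~ e]| = 2 ^ n.
  rewrite -[n in 2 ^ n]card_ord -cardsT -card_powerset powersetT.
  rewrite -(cardsID [set x : {set 'I_n} | odd #|x| == e] setT) setTI; congr (_ + #|pred_of_set _|).
  by apply/setP => x; rewrite !inE; case: odd; case: (e).
have -> : 2 ^ n = (2 ^ n.-1).*2 by rewrite -mul2n -expnS prednK.
by rewrite c addnn => /double_inj.
Qed.

End Parity.

(** * Walls against the isoperimetric inequality *)

Section EdgeSignsContradiction.
Variables (n k M D p q : nat) (pos : {set 'I_n} -> nat).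
Implicit Types (x y : {set 'I_n}) (e : bool).
Hypothesis pos_inj : injective pos.
Hypothesis pos_lt : forall x, pos x < 2 ^ n.
Hypothesis pos_gap : forall i x, pos x + k <= pos (flip i x) \/ pos (flip i x) + k <= pos x.
Hypotheses (n_gt0 : 0 < n) (eM : 2 ^ n = 2 * M) (kD : k + D = M + 1) (D_gt0 : 0 < D)
  (pqk : p + q = k).
Hypothesis hlarge : large_dim n.-1 M D p q.

Lemma no_balanced_ends :
  (forall e : bool, p < #|[set x in early k pos | odd #|x| == e]|) ->
  (forall e : bool, p < #|[set x in late k pos | odd #|x| == e]|) -> False.
Proof.
move=> he hl; have [hk [R [hR hC hE]]] := hlarge.
have k0 : 0 < k by lia.
have k3 : 2 ^ n <= 3 * k by lia.
have [gam gamS] := sgn_potential pos_lt pos_gap k0 k3 setT.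
have gamE x i : gam x (+) gam (flip i x) = sgn pos x i by apply: gamS; rewrite ?inE ?subsetT.
have hM : M = 2 ^ n.-1 by apply/eqP; rewrite -(eqn_pmul2l (isT : 0 < 2)) -eM -expnS prednK.
pose i0 := Ordinal n_gt0.
have [b0 hb0] := small_side gam false i0; have [b1 hb1] := small_side gam true i0.
have disj_el : early k pos :&: late k pos = set0.
  by apply/setP => x; rewrite !inE; lia.
have wall_out e : wall gam e \subset ~: (early k pos :|: late k pos).
  by apply/subsetP => x xw; rewrite in_setC; exact: (wall_middle pos_lt pos_gap k0 k3 gamE xw).
have cearly : #|early k pos| = k by apply: card_pos_lt => //; lia.
have clate : #|late k pos| = k.
  have -> : late k pos = ~: [set x | pos x < 2 ^ n - k].
    by apply/setP => x; rewrite !inE -leqNgt.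
  by rewrite cardsCs setCK card_cube card_pos_lt // ?subKn //; lia.
(* The walls are disjoint from each other and from both ends, so together they have at most
   [2 * M - 2 * k = 2 * D - 2] vertices. *)
have wsum : #|wall gam false| + #|wall gam true| + 2 * k <= 2 ^ n.
  have dw : wall gam false :&: wall gam true = set0.
    by apply/setP => x; rewrite !inE; case: (odd #|x|); rewrite //= ?andbF.
  have : #|wall gam false :|: wall gam true| <= #|~: (early k pos :|: late k pos)|.
    by apply: subset_leq_card; rewrite subUset !wall_out.
  have := cardsC (early k pos :|: late k pos).
  have := cardsUI (early k pos) (late k pos); have := cardsUI (wall gam false) (wall gam true).
  by rewrite dw disj_el !cards0 card_cube cearly clate; lia.
(* At least [2 * p + 2] of the [M] vertices of parity [e] lie at the ends and hence outside the
   wall. This excludes the first alternative of [layer_expansion]. *)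
have wpar e : #|wall gam e| + 2 * p + 2 <= M.
  pose Ae := [set x in early k pos | odd #|x| == e]; pose Al := [set x in late k pos | odd #|x| == e].
  have cAl : Ae :&: Al = set0.
    by apply/eqP; rewrite -subset0 -disj_el; apply/subsetP => x; rewrite !inE; lia.
  have d2 : wall gam e :&: (Ae :|: Al) = set0.
    apply/eqP; rewrite -subset0; apply/subsetP => x; rewrite in_setI => /andP[/(subsetP (wall_out e))].
    by rewrite inE in_setU => /norP[/negbTE h1 /negbTE h2]; rewrite !inE in h1 h2 *; rewrite h1 h2.
  have : #|wall gam e :|: (Ae :|: Al)| <= #|[set x : {set 'I_n} | odd #|x| == e]|.
    apply: subset_leq_card; rewrite !subUset; apply/and3P; split; apply/subsetP => x;
      by rewrite !inE => /andP[].
  have := cardsUI (wall gam e) (Ae :|: Al); have := cardsUI Ae Al.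
  have := he e; have := hl e; rewrite -/Ae -/Al.
  by rewrite d2 cAl !cards0 card_parity // -hM; lia.
have csum : 2 * p + 2 <= #|side gam false b0| + #|side gam true b1|.
  apply: leq_trans (_ : #|side gam false b0 :|: side gam true b1| <= _); last by rewrite cardsU leq_subr.
  apply: leq_trans (subset_leq_card (extreme_sides pos_lt pos_gap k0 k3 gamE b0 b1)).
  move: (~~ _) => t; rewrite /extreme.
  have -> : [set x in early k pos | odd #|x| != t] = [set x in early k pos | odd #|x| == ~~ t].
    by apply/setP => x; rewrite !inE; case: odd; case: t.
  rewrite cardsU; have -> : [set x in early k pos | odd #|x| == ~~ t] :&:
      [set x in late k pos | odd #|x| == t] = set0.
    by apply/eqP; rewrite -subset0 -disj_el; apply/subsetP => x; rewrite !inE; lia.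
  by rewrite cards0 subn0; have := he (~~ t); have := hl t; lia.
have expand e b : (#|side gam e b|).*2 <= 2 ^ n ->
    (2 * D - 1) * #|side gam e b| <= (2 * p + 2) * #|wall gam e|.
  move=> hb; have en : n.-1.+1 = n by rewrite prednK.
  rewrite en in hR hC hE.
  have cT : #|[set: 'I_n]| = n by rewrite cardsT card_ord.
  have := @layer_expansion n setT R (2 * p + 2) (2 * D - 1) (side gam e b).
  rewrite cT powersetT subsetT => /(_ hR hE isT hb) h.
  have hN := card_nbh_side gam e b; have hw := wpar e.
  case: h => h.
    have := leq_trans h hN; rewrite addnC leq_add2l; move: hw hC; clear.
    by move: #|wall gam e| 'C(n, R) => w c; lia.
  have := leq_trans h (leq_mul (leqnn (2 * p + 2)) hN); clear.
  by rewrite mulnDl mulnDr addnC leq_add2l.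
have h0 := expand false b0 hb0; have h1 := expand true b1 hb1.
(* Summing both expansions would give [(2 * D - 1) * (2 * p + 2) <= (2 * p + 2) * (2 * D - 2)]. *)
have hs : (2 * p + 2) * (#|wall gam false| + #|wall gam true|) <= (2 * p + 2) * (2 * D - 2).
  by rewrite leq_mul2l; apply/orP; right; lia.
have := leq_mul (leqnn (2 * D - 1)) csum.
have : (2 * D - 1) * (2 * p + 2) = (2 * p + 2) * (2 * D - 2) + (2 * p + 2).
  have -> : 2 * D - 1 = (2 * D - 2).+1 by lia.
  by move: (2 * D - 2) (2 * p + 2) => z P; rewrite mulSnr mulnC.
move: h0 h1 hs; have : 0 < 2 * p + 2 by rewrite addn2.
move: (2 * D - 1) (2 * D - 2) (2 * p + 2) (#|side gam false b0|) (#|side gam true b1|)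
  (#|wall gam false|) (#|wall gam true|); lia.
Qed.

End EdgeSignsContradiction.

(** * The upper bound *)

Section Projection.
Variable n : nat.
Implicit Types (x y z v w : {set 'I_n}) (i j : 'I_n).

Lemma setD1_same i x y : x :\ i = y :\ i -> y = x \/ y = flip i x.
Proof.
move=> e; have e' j : j != i -> (j \in y) = (j \in x).
  by move=> ji; have /setP/(_ j) := e; rewrite !inE ji.
have [h|h] := eqVneq (i \in y) (i \in x); [left | right]; apply/setP => j.
  by have [->//|/e'] := eqVneq j i.
rewrite in_flip; have [->|/e'->] := eqVneq j i; last by rewrite addbF.
by move: h; case: (i \in y); case: (i \in x).
Qed.

Lemma setD1_flip i x : flip i x :\ i = x :\ i.
Proof. by apply/setP => j; rewrite !inE in_flip; case: eqP => //; rewrite addbF. Qed.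

Lemma setD1_parity i x y : odd #|x| = odd #|y| -> x :\ i = y :\ i -> x = y.
Proof.
by move=> o /setD1_same[->//|e]; move: o; rewrite e odd_flip; case: odd.
Qed.

Lemma cardsD1T i : #|[set: 'I_n] :\ i| = n.-1.
Proof. by rewrite cardsDS ?subsetT // cardsT card_ord cards1 subn1. Qed.

(** Deleting coordinate [i] is injective on each parity class. The closed neighbourhood of the image
    of [P] and the image of [Q] are together too large to be disjoint, and a common element lifts to
    an edge, possibly one in direction [i]. *)
Lemma parity_edge p (i : 'I_n) (e : bool) (P Q : {set {set 'I_n}}) r :
  tight ([set: 'I_n] :\ i) r p -> p <= #|P| -> 2 ^ n.-1 < p + #|Q| + Dsum n.-1 ->
  {in P, forall x : {set 'I_n}, odd #|x| = e} -> {in Q, forall x : {set 'I_n}, odd #|x| = ~~ e} ->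
  exists2 x, x \in P & exists j, flip j x \in Q.
Proof.
set S := [set: 'I_n] :\ i => tS pP large eP eQ.
pose prj : {set {set 'I_n}} := [set x :\ i | x in P].
pose prjQ : {set {set 'I_n}} := [set x :\ i | x in Q].
have sub (A : {set {set 'I_n}}) : [set x :\ i | x in A] \subset powerset S.
  by apply/subsetP => y /imsetP[x _ ->]; rewrite powersetE setSD // subsetT.
have cP : #|prj| = #|P|.
  by apply: card_in_imset => x y /eP ex /eP ey; apply: setD1_parity; rewrite ex ey.
have cQ : #|prjQ| = #|Q|.
  by apply: card_in_imset => x y /eQ ex /eQ ey; apply: setD1_parity; rewrite ex ey.
have := tight_expansion tS (sub P); rewrite cP cardsD1T => /(_ pP) hN.
have : ~~ [disjoint nbh S prj & prjQ].
  apply/negP => dis; have : #|nbh S prj :|: prjQ| <= 2 ^ n.-1.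
    by rewrite -(cardsD1T i) -card_powerset subset_leq_card // subUset nbh_sub sub.
  have -> : #|nbh S prj :|: prjQ| = #|nbh S prj| + #|Q|.
    by rewrite cardsU (disjoint_setI0 dis) cards0 subn0 cQ.
  move=> ub; suff : 2 ^ n.-1 < 2 ^ n.-1 by rewrite ltnn.
  by apply: leq_trans large (leq_trans _ ub); rewrite addnAC leq_add2r.
move=> /pred0Pn[z /andP[/= /nbhP[_ h] /imsetP[w wQ ez]]].
have ow := eQ w wQ; case: h => [/imsetP[v vP ev]|[j]].
  exists v => //; exists i; rewrite ev in ez.
  case: (setD1_same ez) => [ewv|<- //].
  by move: ow; rewrite ewv (eP v vP); case: (e).
rewrite !inE andbT => ji /imsetP[v vP ev]; exists v => //; exists j.
rewrite ez flipD1 // in ev; suff <- : flip j w = v by rewrite flipK.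
by apply: setD1_parity ev; rewrite odd_flip ow (eP v vP) negbK.
Qed.

End Projection.

Section UpperBound.
Variables (n : nat) (pos : {set 'I_n} -> nat).
Hypothesis n_gt0 : 0 < n.
Hypothesis pos_inj : injective pos.
Hypothesis pos_lt : forall x, pos x < 2 ^ n.

Definition parity_count (e : bool) t := #|[set x : {set 'I_n} | (odd #|x| == e) && (pos x < t)]|.

Lemma parity_count_le e s t :
  parity_count e t <= parity_count e s + #|[set x : {set 'I_n} | (odd #|x| == e) && (s <= pos x < t)]|.
Proof.
apply: leq_trans (leq_card_setU _ _); apply: subset_leq_card; apply/subsetP => x.
by rewrite !inE => /andP[-> ->]; rewrite /= andbT ltnNge orNb.
Qed.

Lemma Dsum_gt0 N : 0 < N -> 0 < Dsum N.
Proof.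
case: N => // N _; rewrite DsumS addn_gt0 bin_gt0.
by have := odd_double_half N; lia.
Qed.

Lemma counting_parity : counting (2 ^ n.-1) (parity_count false) (parity_count true).
Proof.
have eM : 2 * 2 ^ n.-1 = 2 ^ n by rewrite -expnS prednK.
have mono e x y : x <= y -> parity_count e x <= parity_count e y.
  move=> xy; apply: subset_leq_card; apply/subsetP => z; rewrite !inE => /andP[-> h] /=.
  exact: leq_trans h xy.
split; rewrite ?eM; [|exact: mono..|].
  move=> x xn; rewrite -[RHS](card_pos_lt pos_inj pos_lt xn).
  rewrite -(cardsID [set z : {set 'I_n} | odd #|z| == false] [set z | pos z < x]); congr (_ + _);
    congr #|pred_of_set _|; apply/setP => z; rewrite !inE andbC //.
  by case: (odd _); rewrite ?andbT ?andbF.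
have full e : parity_count e (2 ^ n) = 2 ^ n.-1.
  rewrite -(card_parity n_gt0 e); congr #|pred_of_set _|; apply/setP => z.
  by rewrite !inE pos_lt andbT.
by rewrite !full.
Qed.

Lemma antibandwidth_bound :
  exists x i, pos x <= pos (flip i x) <= pos x + (2 ^ n.-1 - Dsum n.-1).
Proof.
have [p [q [epq DM pq tS hcase]]] := parameters n.-1.
set M := 2 ^ n.-1 in epq DM hcase *; set D := Dsum n.-1 in epq DM hcase *.
have eM : 2 ^ n = 2 * M by rewrite -expnS prednK.
(* One more than the claimed bound: if no edge is as short as claimed, all gaps are at least [k]. *)
set k := M - D + 1 in epq *.
have [/existsP[x /existsP[i h]]|hgap] :=
  boolP [exists x, exists i, pos x <= pos (flip i x) <= pos x + (M - D)]; first by exists x, i.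
exfalso.
have gap i x : pos x + k <= pos (flip i x) \/ pos (flip i x) + k <= pos x.
  have h1 : ~~ (pos x <= pos (flip i x) <= pos x + (M - D)).
    by apply: contra hgap => h; apply/existsP; exists x; apply/existsP; exists i.
  have h2 : ~~ (pos (flip i x) <= pos x <= pos (flip i x) + (M - D)).
    apply: contra hgap => h; apply/existsP; exists (flip i x); apply/existsP; exists i.
    by rewrite flipK.
  by move: h1 h2; rewrite /k; clear; lia.
pose i0 := Ordinal n_gt0.
have [r tr] := tS n ([set: 'I_n] :\ i0) (cardsD1T i0).
have p0 : 0 < p by case: tr => I [_ _ _ [_ ->]].
have cross e : crossing M k p q (parity_count e) (parity_count (~~ e)).
  move=> a b c d bM dM bc da hP hQ.
  pose P : {set {set 'I_n}} := [set x : {set 'I_n} | (odd #|x| == e) && (a <= pos x < b)].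
  pose Q : {set {set 'I_n}} := [set x : {set 'I_n} | (odd #|x| == ~~ e) && (c <= pos x < d)].
  have cP : p <= #|P|.
    by rewrite -(leq_add2l (parity_count e a)); apply: leq_trans hP (parity_count_le _ _ _).
  have cQ : q <= #|Q|.
    by rewrite -(leq_add2l (parity_count (~~ e) c)); apply: leq_trans hQ (parity_count_le _ _ _).
  have large : M < p + #|Q| + D by move: cQ epq DM; rewrite /k; clear; lia.
  have eP : {in P, forall x : {set 'I_n}, odd #|x| = e} by move=> x; rewrite inE => /andP[/eqP].
  have eQ : {in Q, forall x : {set 'I_n}, odd #|x| = ~~ e} by move=> x; rewrite inE => /andP[/eqP].
  have [x xP [j]] := parity_edge tr cP large eP eQ.
  move: xP; rewrite !inE => /andP[_ /andP[h1 h2]] /andP[_ /andP[h3 h4]].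
  by have := gap j x; lia.
have cnt := counting_parity; have cnt' := counting_swap cnt.
have kM : k <= 2 * M.
  have M0 : 0 < M by rewrite expn_gt0.
  by rewrite /k; lia.
have kD : k + D = M + 1 by rewrite /k; lia.
case: (window_trichotomy pq epq kM cnt (cross false) (cross true)) => win.
- exact: (no_even_windows pq epq kM cnt (cross true) win).
- exact: (no_even_windows pq epq kM cnt' (cross false) win).
have w0 := win 0 kM; have w1 := win (2 * M - k); rewrite subnK // in w1.
have {}w1 := w1 (leqnn _).
case: hcase => [h|[h|h]].
- by case: w0 => *; lia.
- exact: (no_middle_windows pq epq kM cnt (cross false) (cross true) kD h).
(* The first and the last window each have more than [p] vertices of either parity; these are the
   ends needed for the sign argument. *)
have c0 e : parity_count e 0 = 0.
  by apply: eq_card0 => x; rewrite !inE andbF.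
rewrite !c0 !add0n in w0; have [_ _ _ [cM oM]] := cnt; rewrite cM oM in w1.
have D0 : 0 < D.
  have pM : p < M by case: w1 => w _ _ _; apply: leq_ltn_trans (leq_addl _ _) w.
  apply: Dsum_gt0; rewrite lt0n; apply: contraTneq pM => N0.
  by rewrite /M N0 -leqNgt.
have {}w0 e : p < parity_count e k by case: w0; case: (e).
have {}w1 e : parity_count e (2 * M - k) + p < M by case: w1; case: (e).
apply: (no_balanced_ends pos_inj pos_lt gap n_gt0 eM kD D0 epq h) => e.
  apply: leq_trans (w0 e) _; apply: subset_leq_card; apply/subsetP => x.
  by rewrite !inE andbC.
have full : parity_count e (2 ^ n) = M by rewrite eM; case: (e).
have := parity_count_le e (2 * M - k) (2 ^ n); rewrite full.
have -> : [set x : {set 'I_n} | (odd #|x| == e) && (2 * M - k <= pos x < 2 ^ n)] =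
          [set x in late k pos | odd #|x| == e].
  by apply/setP => x; rewrite !inE pos_lt andbT andbC eM.
move=> h1; rewrite -(ltn_add2l (parity_count e (2 * M - k))).
exact: leq_trans (w1 e) h1.
Qed.

End UpperBound.

(** * Hales numbering and the lower bound *)

Section HalesNumbering.
Variables (n : nat) (i0 : 'I_n).
Implicit Types (x y z : {set 'I_n}).

Definition base := [set: 'I_n] :\ i0.
Definition rank x := #|[set z : {set 'I_n} | (z \subset base) && (wt z < wt x)]|.
Definition hales x := rank (x :\ i0) + 2 ^ n.-1 * odd #|x|.

Lemma n_gt0 : 0 < n.
Proof. exact: leq_ltn_trans (leq0n _) (ltn_ord i0). Qed.

Lemma cube_half : 2 ^ n = 2 ^ n.-1 + 2 ^ n.-1.
Proof. by rewrite addnn -mul2n -expnS prednK // n_gt0. Qed.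

Lemma D1_base x : x :\ i0 \subset base.
Proof. by rewrite setSD // subsetT. Qed.

Lemma rank_lt x : x \subset base -> rank x < 2 ^ n.-1.
Proof.
move=> xb; rewrite -(cardsD1T i0) -card_powerset; apply: proper_card.
apply/properP; split; first by apply/subsetP => z; rewrite !inE => /andP[].
by exists x; rewrite !inE ?xb ?ltnn ?andbF.
Qed.

Lemma rank_mono x y : x \subset base -> wt x < wt y -> rank x < rank y.
Proof.
move=> xb xy; apply: proper_card; apply/properP; split.
  by apply/subsetP => z; rewrite !inE => /andP[-> h]; exact: ltn_trans h xy.
by exists x; rewrite !inE xb // ltnn.
Qed.

Lemma hales_lt x : hales x < 2 ^ n.
Proof.
have := rank_lt (D1_base x); rewrite /hales cube_half.
by case: odd; rewrite ?muln1 ?muln0; lia.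
Qed.

Lemma hales_inj : injective hales.
Proof.
move=> x y; have hx := rank_lt (D1_base x); have hy := rank_lt (D1_base y).
rewrite /hales => e.
have o : odd #|x| = odd #|y| by move: e; do 2!case: odd; rewrite ?muln1 ?muln0; lia.
apply: (setD1_parity o (i := i0)); apply: wt_inj.
have {}e : rank (x :\ i0) = rank (y :\ i0) by move: e; rewrite o; lia.
case: (ltngtP (wt (x :\ i0)) (wt (y :\ i0))) => // h.
  by have := rank_mono (D1_base x) h; rewrite e ltnn.
by have := rank_mono (D1_base y) h; rewrite e ltnn.
Qed.

(** The segment ending at [y] has [(rank y).+1] elements. Its neighbourhood is again an initial
    segment, contains [x], hence everything up to [x], and exceeds it by at most [Dsum n.-1]
    elements. *)
Lemma rank_adjacent x y : x \subset base -> y \subset base ->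
  x = y \/ (exists2 j, j \in base & flip j x = y) -> rank x <= rank y + Dsum n.-1.
Proof.
move=> xb yb adj; pose I := [set z : {set 'I_n} | (z \subset base) && (wt z <= wt y)].
have hI : initial base I.
  split; first by apply/subsetP => z; rewrite !inE => /andP[].
  move=> u v; rewrite !inE => /andP[_ uy] -> /ltnW vu.
  exact: leq_trans vu uy.
have yI : y \in I by rewrite inE yb leqnn.
have cI : #|I| = (rank y).+1.
  rewrite (cardsD1 y) yI add1n; congr _.+1; congr #|pred_of_set _|; apply/setP => z.
  rewrite !inE ltn_neqAle; case: (z \subset base); rewrite /= ?andbF //.
  by congr (_ && _); apply/idP/idP; [apply: wt_neq | apply: contra => /eqP->].
have xN : x \in nbh base I.
  apply/nbhP; split=> //; case: adj => [->|[j jb e]]; first by left.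
  by right; exists j; rewrite ?e.
have sub : [set z : {set 'I_n} | (z \subset base) && (wt z < wt x)] :|: [set x] \subset nbh base I.
  rewrite subUset sub1set xN andbT; apply/subsetP => z; rewrite inE => /andP[zb zx].
  exact: initial_le (initial_nbh hI) xN zb (ltnW zx).
have := subset_leq_card sub; rewrite setUC cardsU1 !inE ltnn andbF add1n => h.
have := leq_trans h (initial_nbh_le hI); rewrite cI (cardsD1T i0) addSn ltnS; exact.
Qed.

Lemma hales_gap j x : ~~ odd #|x| -> hales x + (2 ^ n.-1 - Dsum n.-1) <= hales (flip j x).
Proof.
move=> ox; rewrite /hales odd_flip (negbTE ox) muln0 muln1 addn0.
have : rank (x :\ i0) <= rank (flip j x :\ i0) + Dsum n.-1.
  apply: rank_adjacent; rewrite ?D1_base //; have [->|ji] := eqVneq j i0.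
    by left; rewrite setD1_flip.
  by right; exists j; rewrite ?inE ?ji // flipD1.
have := rank_lt (D1_base x); lia.
Qed.

End HalesNumbering.

(** * From subsets to cube vertices, and the antibandwidth itself *)

Section Cube.
Variable n : nat.
Implicit Types (f g : cube_vertex n) (x : {set 'I_n}) (i : 'I_n).

Definition vset f : {set 'I_n} := [set i | f i].
Definition setv x : cube_vertex n := [ffun i => i \in x].

Lemma vsetK : cancel vset setv.
Proof. by move=> f; apply/ffunP => i; rewrite ffunE inE. Qed.

Lemma setvK : cancel setv vset.
Proof. by move=> x; apply/setP => i; rewrite inE ffunE. Qed.

Lemma cube_adjP f g : reflect (exists i, vset g = flip i (vset f)) (cube_adj f g).
Proof.
apply: (iffP cards1P) => -[i e]; exists i.
  apply/setP => j; rewrite in_flip !inE.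
  by have /setP/(_ j) := e; rewrite !inE => <-; case: (f j); case: (g j).
apply/setP => j; rewrite !inE; have /setP/(_ j) := e; rewrite in_flip !inE => ->.
by case: (f j); case: (j == i).
Qed.

Lemma card_vertices : #|cube_vertex n| = 2 ^ n.
Proof. by rewrite card_ffun card_bool card_ord. Qed.

Lemma min_edge_gap_le (T : finType) (e : rel T) (eta : T -> nat) v w :
  e v w -> min_edge_gap e eta <= absdiff (eta v) (eta w).
Proof.
move=> evw; rewrite /min_edge_gap.
have : (v, w) \in index_enum (T * T)%type by rewrite mem_index_enum.
elim: (index_enum _) => // a s IH; rewrite inE big_cons => /orP[/eqP<-|/IH h] /=.
  by rewrite evw geq_minl.
by case: ifP => // _; apply: leq_trans (geq_minr _ _) h.
Qed.

(** The bound [d <= #|T|] is there for the default value with which the iterated minimum starts. *)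
Lemma min_edge_gap_ge (T : finType) (e : rel T) (eta : T -> nat) d : d <= #|T| ->
  (forall v w, e v w -> d <= absdiff (eta v) (eta w)) -> d <= min_edge_gap e eta.
Proof.
move=> dT h; apply: (big_ind (fun m => d <= m)) => //; first by move=> a b; rewrite leq_min => -> ->.
by move=> [v w]; apply: h.
Qed.

End Cube.

Theorem theorem3 (n : nat) : 1 <= n ->
  antibandwidth (@cube_adj n) =
  2 ^ n.-1 - \sum_(0 <= m < n.-1) 'C(m, m./2).
Proof.
move=> n0; rewrite -/(Dsum n.-1); apply/eqP; rewrite eqn_leq; apply/andP; split.
  apply/bigmax_leqP => g /injectiveP gI.
  pose pos x : nat := g (setv x).
  have posI : injective pos by move=> x y /val_inj/gI/(can_inj (@setvK n)).
  have pos_lt x : pos x < 2 ^ n by rewrite -(card_vertices n) ltn_ord.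
  have [x [i /andP[h1 h2]]] := antibandwidth_bound n0 posI pos_lt.
  have adj : cube_adj (setv x) (setv (flip i x)).
    by apply/cube_adjP; exists i; rewrite !setvK.
  apply: leq_trans (min_edge_gap_le _ adj) _.
  by rewrite /absdiff -!/(pos _); lia.
pose i0 := Ordinal n0.
have lt f : hales i0 (vset f) < #|cube_vertex n| by rewrite card_vertices hales_lt.
pose g : {ffun cube_vertex n -> 'I_#|cube_vertex n|} := [ffun f => Ordinal (lt f)].
have gI : injectiveb g.
  apply/injectiveP => f f'; rewrite !ffunE => -[] /hales_inj; exact: can_inj (@vsetK n) f f'.
apply: leq_trans (leq_bigmax_cond _ gI); apply: min_edge_gap_ge.
  rewrite card_vertices; apply: leq_trans (leq_subr _ _) _.
  by rewrite leq_exp2l // leq_pred.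
move=> f f' /cube_adjP[i e]; rewrite !ffunE /= e.
have [o|o] := boolP (odd #|vset f|); last first.
  by have := hales_gap i0 i o; rewrite /absdiff; lia.
have := hales_gap i0 i (x := flip i (vset f)); rewrite flipK odd_flip o => /(_ isT).
by rewrite /absdiff; lia.
Qed.
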